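(* Let $c\ge2$ be an integer. Then for any integer $0\le a\le c-1$ we have, as $n\to\infty$, $$\overline N(a,c,n)\sim\frac{\overline p(n)}{c}\sim\frac1c\cdot\frac{e^{\pi\sqrt n}}{8n}.$$
   Context: An overpartition of $n$ is a partition of $n$ in which the first occurrence of each part may be overlined. $\overline p(n)$ denotes the number of overpartitions of $n$. The rank of an overpartition is its largest part minus the number of its parts. $\overline N(a,c,n)$ denotes the number of overpartitions of $n$ with rank congruent to $a$ modulo $c$. Here $f(n)\sim g(n)$ means $f(n)/g(n)\to1$. *)

(* Defs.v *)
From mathcomp Require Import all_boot all_order all_algebra.
From mathcomp Require Import all_classical all_reals all_analysis.
Set Implicit Arguments.
Unset Strict Implicit.
Unset Printing Implicit Defensive.
Import Order.TTheory GRing.Theory Num.Theory.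
Import numFieldNormedType.Exports.

Local Open Scope nat_scope.

(* A partition is written as its nonincreasing list of positive parts, each
   part carrying a flag: (k, true) is an overlined k. *)

Definition parts (s : seq (nat * bool)) : seq nat := unzip1 s.

(* The last conjunct: an entry may be overlined only if no earlier entry is
   the same part. *)
Definition is_overpartition (n : nat) (s : seq (nat * bool)) : bool :=
  [&& sorted geq (parts s),
      all (fun k => 0 < k) (parts s),
      sumn (parts s) == n
    & pairwise (fun x y => y.2 ==> (x.1 != y.1)) s].

(* The empty overpartition gets rank 0. *)
Definition rank (s : seq (nat * bool)) : int :=
  ((\max_(k <- parts s) k)%:Z - (size s)%:Z)%R.

(* An overpartition of n has at most n parts, all at most n, so the lists below
   range over a finite type and still reach every overpartition of n: see
   overpartition_code. *)
Definition decode n (s : n.-bseq ('I_n.+1 * bool)) : seq (nat * bool) :=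
  [seq (val x.1, x.2) | x <- s].

Definition overpartitions (n : nat) : {set n.-bseq ('I_n.+1 * bool)} :=
  [set s | is_overpartition n (decode s)].

Definition pbar (n : nat) : nat := #|overpartitions n|.

Definition Nbar (a c n : nat) : nat :=
  #|[set s in overpartitions n | (rank (decode s) == a %[mod c])%Z]|.

Lemma overpartition_code n s : is_overpartition n s ->
  exists! t : n.-bseq ('I_n.+1 * bool), decode t = s.
Proof.
case/and4P => _ s_gt0 /eqP s_sum _.
have size_le (u : seq nat) : all (fun k => 0 < k) u -> size u <= sumn u.
  elim: u => //= k u IHu /andP[k_gt0 /IHu le_u].
  by rewrite -add1n leq_add.
have part_le (u : seq nat) k : k \in u -> k <= sumn u.
  elim: u => //= l u IHu; rewrite inE => /predU1P[-> | /IHu le_k].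
    exact: leq_addr.
  exact: leq_trans le_k (leq_addl _ _).
have s_size : size [seq (inord x.1 : 'I_n.+1, x.2) | x <- s] <= n.
  by rewrite size_map -(size_map fst) -[leqRHS]s_sum size_le.
have dec_inj : injective (@decode n).
  move=> t u /inj_map dec_tu; apply/val_inj/dec_tu => -[i b] [j d] /=.
  by case=> /val_inj-> ->.
have dec_s : decode (Bseq s_size) = s.
  rewrite /decode /= -map_comp -[RHS]map_id; apply/eq_in_map => -[k b] ks /=.
  rewrite inordK // ltnS -s_sum; apply: part_le.
  by apply/mapP; exists (k, b).
by exists (Bseq s_size); split=> // t dec_t; apply: dec_inj; rewrite dec_s.
Qed.

Definition asymp_equiv (R : realType) (f g : nat -> R) : Prop :=
  ((fun n => f n / g n) @ \oo --> (1 : R))%R%classic.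

(* Main.v *)
(** By Gauss' identity [sum_k (-1)^k q^(k^2) = prod_m (1 - q^m) / (1 + q^m)], the
    overpartition numbers p are the convolution inverse of the theta coefficients.
    Hence beta = F * p, where beta(n) = cosh (pi sqrt n) and
    F(N) = sum_(k^2 <= N) (-1)^k beta(N - k^2). Letting M tend to infinity in an
    exact identity for the Chebyshev polynomial T_M at the nodes pi k / M gives, for
    every real s,
      sum_(k in Z) ((-1)^k Ch(pi^2 (s - k^2)) - 1) = pi^2 s / 2,   Ch = chsqrt,
    and comparing s = N with s = - N yields F(N) = pi^2 N + o(N). So
    sum_j j p(n - j) is asymptotic to beta(n) / pi^2, and since p is nondecreasing,
    two differencing steps give p(n) ~ e^(pi sqrt n) / (8 n).

    For the rank, inserting a part 2 lowers the rank by 1 and appending two parts 1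
    lowers it by 2, up to two exceptions. These injections from size n to size
    n + 2, summed over the residues modulo c, show that neighbouring rank classes
    differ by at most p(n + 2) - p(n) + O(c) = o(p(n)). *)

Require Import Defs.
From mathcomp Require Import all_boot all_order all_algebra.
From mathcomp Require Import all_classical all_reals all_analysis.
From mathcomp Require Import ring lra zify.
Set Implicit Arguments.
Unset Strict Implicit.
Unset Printing Implicit Defensive.
Import Order.TTheory GRing.Theory Num.Theory.
Import numFieldNormedType.Exports.

Local Open Scope ring_scope.

(** The Chebyshev identity reads off the two leading Fourier coefficients of T_M(cos t + e) from its
    values at the nodes. For e = pi^2 s / (2 M^2) the point cos(pi k / M) + e is 1 + pi^2 (s - k^2)
    / (2 M^2) to leading order, where T_M tends to Ch(pi^2 (s - k^2)). At s = N the terms with k^2 >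
    N add up to a quantity of order N, so that identity alone yields only a lower bound for F(N).
    The terms at s = - N nearly repeat them, since sqrt(k^2 - N) and sqrt(k^2 + N) lie almost
    symmetrically about k; the difference cancels them and doubles pi^2 N / 2. Knowing F only up to
    o(N) determines double sums of p and not p itself. Monotonicity brings the asymptotics back down
    over windows of length about sqrt n, on which e^(pi sqrt n) changes by a bounded factor. For the
    rank, one injection only relates classes at different sizes. Two injections that raise the size
    equally and lower the rank by 1 and by 2 compare two neighbouring classes at n with one and the
    same class at n + 2. *)

(** * Enumeration of overpartitions and transport of counts along injections *)

Lemma decode_inj n : injective (@Defs.decode n).
Proof.
move=> t u; rewrite /decode => dec_tu; apply/val_inj.
apply: (inj_map _ dec_tu) => -[i b] [j d] /=.
by case=> /val_inj-> ->.
Qed.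

(** Plain lists, whose type does not mention [n], so that overpartitions of different sizes can be
    compared. *)
Definition ovlist (n : nat) : seq (seq (nat * bool)) :=
  [seq Defs.decode s | s in overpartitions n].

Lemma ovlist_uniq n : uniq (ovlist n).
Proof. by rewrite map_inj_uniq ?enum_uniq //; exact: decode_inj. Qed.

Lemma mem_ovlist n s : (s \in ovlist n) = is_overpartition n s.
Proof.
apply/fintype.imageP/idP => [[t]|ov_s]; first by rewrite inE => ? ->.
have [t [dec_t _]] := overpartition_code ov_s.
by exists t => //; rewrite inE dec_t.
Qed.

Lemma size_ovlist n : size (ovlist n) = pbar n.
Proof. by rewrite size_map -cardE. Qed.

Lemma count_ovlist n (P : pred (seq (nat * bool))) :
  count P (ovlist n) = #|[set s in overpartitions n | P (Defs.decode s)]|.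
Proof.
rewrite count_map -size_filter cardE.
apply/perm_size/uniq_perm; [exact/filter_uniq/enum_uniq|exact: enum_uniq|].
by move=> s; rewrite mem_filter !mem_enum !inE andbC.
Qed.

Lemma leq_count_ovlist n m (f : seq (nat * bool) -> seq (nat * bool))
    (P Q : pred (seq (nat * bool))) :
    (forall s, is_overpartition m s -> P s ->
       is_overpartition n (f s) && Q (f s)) ->
    {in [pred s | is_overpartition m s] &, injective f} ->
  (count P (ovlist m) <= count Q (ovlist n))%N.
Proof.
move=> fPQ f_inj; rewrite -!size_filter -(size_map f).
apply: uniq_leq_size => [|t /mapP[s]].
  rewrite map_inj_in_uniq ?filter_uniq ?ovlist_uniq // => s t.
  by rewrite !mem_filter !mem_ovlist => /andP[_ ov_s] /andP[_ ov_t]; apply: f_inj.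
rewrite mem_filter mem_ovlist => /andP[Ps ov_s] ->.
by rewrite mem_filter mem_ovlist andbC fPQ.
Qed.

(** * Recurrences in the bound on the largest part *)

Definition parts_le (m : nat) (s : seq (nat * bool)) : bool :=
  all (fun k => (k <= m)%N) (parts s).

Lemma is_overpartition_nil n : is_overpartition n [::] = (n == 0%N).
Proof. by rewrite /is_overpartition /= andbT eq_sym. Qed.

Lemma is_overpartition_cons n k b s :
  is_overpartition n ((k, b) :: s) =
  [&& (0 < k)%N, (k <= n)%N, is_overpartition (n - k) s, parts_le k s
    & (k, true) \notin s].
Proof.
rewrite /is_overpartition /= path_sortedE; last exact/rev_trans/leq_trans.
rewrite -/(parts_le k s).
have -> : all (fun y : nat * bool => y.2 ==> (k != y.1)) s = ((k, true) \notin s).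
  elim: s => //= -[l d] s ->; rewrite inE negb_or xpair_eqE; congr (_ && _).
  by case: d => //=; rewrite ?andbT ?andbF.
case: (leqP k n) => [le_kn|lt_nk].
  have -> : (k + sumn (parts s) == n)%N = (sumn (parts s) == n - k)%N.
    by apply/eqP/eqP; lia.
  by case: (parts_le k s); case: (sorted _ _); case: (0 < k)%N;
     case: all; case: (_ == _); case: pairwise; case: (_ \notin _).
suff -> : (k + sumn (parts s) == n)%N = false by rewrite /= !andbF.
by apply/negbTE/eqP; lia.
Qed.

(** The condition under which a part [m], overlined or not, may be put in front of [s]. *)
Definition parts_le_plain (m : nat) (s : seq (nat * bool)) : bool :=
  parts_le m s && ((m, true) \notin s).

Lemma parts_leW m n s : (m <= n)%N -> parts_le m s -> parts_le n s.
Proof. by move=> le_mn; apply: sub_all => k /leq_trans; apply. Qed.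

Lemma parts_le_true m n b s : (m < n)%N -> parts_le m s -> (n, b) \notin s.
Proof.
move=> lt_mn /allP le_m; apply/negP => /(map_f fst) /le_m /=.
by rewrite leqNgt lt_mn.
Qed.

(* Both recurrences below split off the largest part, which is the head. *)
Lemma count_parts_leS m n :
  count (parts_le m.+1) (ovlist n) =
  (count (parts_le m) (ovlist n)
   + 2 * (if m < n then count (parts_le_plain m.+1) (ovlist (n - m.+1)) else 0))%N.
Proof.
pose L := if (m < n)%N then [seq s <- ovlist (n - m.+1) | parts_le_plain m.+1 s]
          else [::].
have memL s : (s \in L) =
    [&& (m < n)%N, is_overpartition (n - m.+1) s & parts_le_plain m.+1 s].
  by rewrite /L; case: ifP => // _; rewrite mem_filter mem_ovlist andbC.
have uL : uniq L by rewrite /L; case: ifP => // _; rewrite filter_uniq ?ovlist_uniq.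
have -> : (if (m < n)%N then count (parts_le_plain m.+1) (ovlist (n - m.+1)) else 0%N)
    = size L by rewrite /L; case: ifP; rewrite ?size_filter.
pose h b (s : seq (nat * bool)) := (m.+1, b) :: s.
have hinj b : injective (h b) by move=> s t [].
have -> : (2 * size L = size (map (h false) L ++ map (h true) L))%N.
  by rewrite size_cat !size_map mul2n addnn.
rewrite -!size_filter -size_cat; apply/perm_size/uniq_perm.
- exact/filter_uniq/ovlist_uniq.
- rewrite cat_uniq filter_uniq ?ovlist_uniq //= cat_uniq !map_inj_uniq // uL /= andbT.
  apply/andP; split.
    apply/hasPn => s; rewrite mem_cat mem_filter => /orP[] /mapP[t _ ->];
    by rewrite /parts_le /= ltnn.
  by apply/hasPn => s /mapP[t _ ->]; apply/negP => /mapP[u _ []].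
move=> s; rewrite mem_cat !mem_filter mem_cat mem_ovlist.
have memh b k d t : ((k, d) :: t \in map (h b) L) = [&& k == m.+1, d == b & t \in L].
  apply/mapP/idP => [[u uLu [-> -> ->]]|/and3P[/eqP-> /eqP-> tL]].
    by rewrite !eqxx.
  by exists t.
case: s => [|[k b] s].
  rewrite /= [_ \in map _ _ as X in X || _](_ : _ = false); last first.
    by apply/negP => /mapP[].
  rewrite [_ \in _](_ : _ = false) ?orbF //.
  by apply/negP => /mapP[].
rewrite !memh memL is_overpartition_cons /= /parts_le_plain.
rewrite /parts_le /= -!/(parts_le _ _).
case: (ltngtP k m.+1) => [lt_km|gt_km|->] /=.
- rewrite ltnS in lt_km; rewrite lt_km orbF /=.
  case: (boolP (parts_le k s)) => [ks|_]; last by rewrite !andbF.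
  by rewrite (parts_leW lt_km ks) (parts_leW (leqW lt_km) ks).
- by rewrite leqNgt (ltnW gt_km).
- by rewrite ltnn /=; case: b => /=; rewrite ?orbF;
     case: (m < n)%N; case: parts_le => /=; rewrite ?andbF.
Qed.

Lemma count_parts_le_plainS m n :
  count (parts_le_plain m.+1) (ovlist n) =
  (count (parts_le m) (ovlist n)
   + (if m < n then count (parts_le_plain m.+1) (ovlist (n - m.+1)) else 0))%N.
Proof.
pose L := if (m < n)%N then [seq s <- ovlist (n - m.+1) | parts_le_plain m.+1 s]
          else [::].
have memL s : (s \in L) =
    [&& (m < n)%N, is_overpartition (n - m.+1) s & parts_le_plain m.+1 s].
  by rewrite /L; case: ifP => // _; rewrite mem_filter mem_ovlist andbC.
have uL : uniq L by rewrite /L; case: ifP => // _; rewrite filter_uniq ?ovlist_uniq.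
have -> : (if (m < n)%N then count (parts_le_plain m.+1) (ovlist (n - m.+1)) else 0%N)
    = size L by rewrite /L; case: ifP; rewrite ?size_filter.
pose h (s : seq (nat * bool)) := (m.+1, false) :: s.
rewrite -(size_map h) -!size_filter -size_cat; apply/perm_size/uniq_perm.
- exact/filter_uniq/ovlist_uniq.
- rewrite cat_uniq filter_uniq ?ovlist_uniq //= map_inj_uniq ?uL ?andbT; last first.
    by move=> s t [].
  by apply/hasPn => s; rewrite mem_filter => /mapP[t _ ->]; rewrite /parts_le /= ltnn.
move=> s; rewrite mem_cat !mem_filter mem_ovlist.
case: s => [|[k b] s].
  by rewrite orbC [_ \in _](_ : _ = false) //; apply/negP => /mapP[].
have -> : ((k, b) :: s \in map h L) = [&& k == m.+1, b == false & s \in L].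
  apply/mapP/idP => [[u uLu [-> -> ->]]|/and3P[/eqP-> /eqP-> tL]].
    by rewrite !eqxx.
  by exists s.
rewrite memL is_overpartition_cons /= /parts_le_plain.
rewrite /parts_le /= -!/(parts_le _ _) inE negb_or xpair_eqE.
case: (ltngtP k m.+1) => [lt_km|gt_km|->] /=.
- rewrite ltnS in lt_km; rewrite lt_km orbF.
  case: (boolP (parts_le k s)) => [ks|_]; last by rewrite !andbF.
  rewrite (parts_leW lt_km ks) (parts_leW (leqW lt_km) ks).
  by rewrite (parts_le_true _ _ ks).
- by rewrite leqNgt (ltnW gt_km).
- rewrite ltnn; case: b => /=; rewrite ?andbF //.
  by case: (m < n)%N; case: parts_le; case: is_overpartition;
     case: (_ \in s).
Qed.

Lemma count_parts_le0 n : count (parts_le 0) (ovlist n) = (n == 0%N).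
Proof.
case: n => [|n].
  rewrite /= -size_filter (@perm_size _ _ [:: [::]]) //.
  apply: uniq_perm; rewrite ?filter_uniq ?ovlist_uniq // => s.
  rewrite mem_filter mem_ovlist inE; case: s => [|[k b] s]; first by [].
  by rewrite is_overpartition_cons /= leqn0; case: k => //=; rewrite andbF.
apply/eqP; rewrite /= eqn0Ngt -has_count; apply/hasPn => s.
rewrite mem_ovlist; case: s => [|[k b] s]; first by rewrite is_overpartition_nil.
by rewrite is_overpartition_cons /parts_le /= leqn0; case: k.
Qed.

Lemma count_parts_le_all m n :
  (n <= m)%N -> count (parts_le m) (ovlist n) = pbar n.
Proof.
move=> le_nm; rewrite -size_ovlist; apply/eqP; rewrite -all_count.
apply/allP => s; rewrite mem_ovlist => /and4P[_ _ /eqP s_sum _].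
apply/allP => k ks; apply: leq_trans le_nm; rewrite -s_sum.
elim: (parts s) ks => //= l u IHu; rewrite inE => /predU1P[->|/IHu le_k].
  exact: leq_addr.
exact: leq_trans le_k (leq_addl _ _).
Qed.
(** * Gauss' identity *)

(** Extension by zero to the integers turns multiplication by q^m into the translation x - m, free
    of truncated subtraction. *)
Definition zext (f : nat -> int) (x : int) : int := if x is Posz n then f n else 0.

Lemma zext_lt0 f x : x < 0 -> zext f x = 0.
Proof. by case: x. Qed.

Lemma zext_shift f (x : int) (m : nat) :
  zext f (x - m%:Z) = zext (fun n => if (m <= n)%N then f (n - m)%N else 0) x.
Proof.
case: x => n; last by rewrite zext_lt0 //; lia.
rewrite [RHS]/zext; case: leqP => [le_mn|lt_nm]; last by rewrite zext_lt0 //; lia.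
by rewrite subzn.
Qed.

Definition ov_le (m : nat) : int -> int :=
  zext (fun n => (count (parts_le m) (ovlist n))%:Z).

(* The generating function of [dov_plain s] is 2 (1 + q) ... (1 + q^(s-1)) /
   ((1 - q) ... (1 - q^s)), and 1 at [s = 0]. *)
Definition dov_plain (s : nat) : int -> int :=
  if s is 0 then zext (fun n => (n == 0%N)%:R)
  else zext (fun n => (2 * count (parts_le_plain s) (ovlist n))%N%:Z).

Lemma dov_plain_lt0 s x : x < 0 -> dov_plain s x = 0.
Proof. by case: s => [|s]; apply: zext_lt0. Qed.

Lemma ov_leS m x :
  ov_le m.+1 x = ov_le m x + dov_plain m.+1 (x - m.+1%:Z).
Proof.
rewrite /dov_plain zext_shift; case: x => n; last by rewrite /ov_le /= addr0.
rewrite /ov_le /zext count_parts_leS PoszD.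
by case: ifP.
Qed.

Lemma dov_plainS m x :
  dov_plain m.+1 x = 2 * ov_le m x + dov_plain m.+1 (x - m.+1%:Z).
Proof.
rewrite /dov_plain zext_shift; case: x => n; last by rewrite /ov_le /= mulr0.
rewrite /ov_le /zext count_parts_le_plainS mulnDr PoszD PoszM.
by case: ifP.
Qed.

Lemma ov_le0 x : ov_le 0 x = dov_plain 0 x.
Proof. by case: x => n //; rewrite /ov_le /= count_parts_le0; case: n. Qed.

Lemma ov_le_rec m x :
  ov_le m.+1 x - ov_le m.+1 (x - m.+1%:Z) = ov_le m x + ov_le m (x - m.+1%:Z).
Proof. by rewrite !ov_leS (dov_plainS m (x - _)); ring. Qed.

(** In generating functions, (1 - q^(m+1)) D_(m+1) = (1 + q^m) D_m. At m = 0 the factor 1 + q^0 = 2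
    is correct because D_0 = 1 lacks the factor 2 of the other D_s. *)
Lemma dov_plain_rec m x :
  dov_plain m.+1 x - dov_plain m.+1 (x - m.+1%:Z) =
  dov_plain m x + dov_plain m (x - m%:Z).
Proof.
rewrite dov_plainS addrK; case: m => [|m].
  by rewrite ov_le0 subr0 mulrC mulr_natr mulr2n.
by rewrite ov_leS (dov_plainS m x); ring.
Qed.

(** Cancellation of the factor 1 - q^(m+1) in series without negative exponents. *)
Lemma shift_periodic_eq0 (f : int -> int) (m : nat) :
  (forall x, x < 0 -> f x = 0) -> (forall x, f x = f (x - m.+1%:Z)) ->
  forall x, f x = 0.
Proof.
move=> f_lt0 f_per [] n; last exact: f_lt0.
elim/ltn_ind: n => n IHn; rewrite f_per.
case: (leqP m.+1 n) => [le_mn|lt_nm]; last by apply: f_lt0; lia.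
by rewrite subzn // IHn //; lia.
Qed.

Definition theta_sum (m : nat) (f : int -> int) (x : int) : int :=
  f x + 2 * \sum_(i < m) (-1) ^+ i.+1 * f (x - (i.+1 ^ 2)%N%:Z).

(** The summand at s has no term below q^(s (m+1)), so the whole series is 1 + O(q^(m+1)). *)
Definition gauss_tail (m : nat) (x : int) : int :=
  \sum_(s < m.+1) (-1) ^+ s * dov_plain s (x - (s * m.+1)%N%:Z).

(* Finite form of Gauss' identity. With n = m+1, both sides satisfy
   (1 - q^n) X_n = (1 + q^n) X_m + the same correction; on the right this is
   the telescoping of [G]. *)
Lemma theta_sum_ov_le m x : theta_sum m (ov_le m) x = gauss_tail m x.
Proof.
elim: m x => [|m IHm] x.
  rewrite /theta_sum /gauss_tail big_ord0 big_ord_recl big_ord0 /=.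
  rewrite mulr0 !addr0 expr0 mul1r. exact: ov_le0.
apply/eqP; rewrite -subr_eq0; apply/eqP; move: x.
apply: (@shift_periodic_eq0 _ m) => [x x_lt0|x].
  rewrite /theta_sum /gauss_tail big1 => [|i _]; last first.
    by rewrite /ov_le zext_lt0 ?mulr0 //; lia.
  rewrite big1 => [|i _]; first by rewrite /ov_le zext_lt0.
  by rewrite dov_plain_lt0 ?mulr0 //; lia.
set n := m.+1.
(* Write P_m and D_n for the series of [ov_le m] and [dov_plain n]. The correction is the new theta
   term: (1 - q^n) D_n = 2 P_m gives (1 - q^(2n)) D_n = 2 (1 + q^n) P_m. *)
have Hl : theta_sum n (ov_le n) x - theta_sum n (ov_le n) (x - n%:Z) =
    gauss_tail m x + gauss_tail m (x - n%:Z) +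
    (-1) ^+ n * (dov_plain n (x - (n ^ 2)%N%:Z)
                 - dov_plain n (x - (n ^ 2)%N%:Z - (2 * n)%N%:Z)).
  rewrite -!IHm.
  have -> : dov_plain n (x - (n ^ 2)%N%:Z)
            - dov_plain n (x - (n ^ 2)%N%:Z - (2 * n)%N%:Z) =
      2 * (ov_le m (x - (n ^ 2)%N%:Z) + ov_le m (x - n%:Z - (n ^ 2)%N%:Z)).
    rewrite (dov_plainS m (x - _)) (dov_plainS m (x - _ - n%:Z)).
    have -> : x - (n ^ 2)%N%:Z - n%:Z - n%:Z = x - (n ^ 2)%N%:Z - (2 * n)%N%:Z.
      by rewrite PoszM; ring.
    have -> : x - n%:Z - (n ^ 2)%N%:Z = x - (n ^ 2)%N%:Z - n%:Z by ring.
    by ring.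
  have -> : theta_sum n (ov_le n) x - theta_sum n (ov_le n) (x - n%:Z) =
      theta_sum n (fun y => ov_le m y + ov_le m (y - n%:Z)) x.
    rewrite /theta_sum -ov_le_rec.
    under [in RHS]eq_bigr => i _.
      rewrite -ov_le_rec (_ : x - _ - n%:Z = x - n%:Z - (i.+1 ^ 2)%N%:Z); last by ring.
      rewrite mulrBr; over.
    by rewrite sumrB; ring.
  rewrite /theta_sum (_ : \sum_(i < n) _ =
    \sum_(i < n) (-1) ^+ i.+1 * ov_le m (x - (i.+1 ^ 2)%N%:Z) +
    \sum_(i < n) (-1) ^+ i.+1 * ov_le m (x - n%:Z - (i.+1 ^ 2)%N%:Z)); last first.
    rewrite -big_split; apply: eq_bigr => i _.
    by rewrite /= -mulrDr; congr (_ * (_ + ov_le m _)); ring.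
  by rewrite !big_ord_recr /= -/n; ring.
suff Hr : gauss_tail n x - gauss_tail n (x - n%:Z) =
    gauss_tail m x + gauss_tail m (x - n%:Z) +
    (-1) ^+ n * (dov_plain n (x - (n ^ 2)%N%:Z)
                 - dov_plain n (x - (n ^ 2)%N%:Z - (2 * n)%N%:Z)).
  move: Hl; rewrite -Hr => /eqP; rewrite subr_eq => /eqP ->.
  by ring.
(* Termwise, 1 + q^n - q^s (1 - q^n) = (1 - q^s) + q^n (1 + q^s). The first summand produces [G s],
   the second [- G s.+1] by [dov_plain_rec]; moreover [G 0 = 0]. *)
pose G (s : nat) : int := (-1) ^+ s *
  (dov_plain s (x - (s * n)%N%:Z) - dov_plain s (x - (s * n)%N%:Z - s%:Z)).
have -> : gauss_tail m x + gauss_tail m (x - n%:Z) =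
    \sum_(s < n) (-1) ^+ s * (dov_plain s (x - (s * n.+1)%N%:Z) -
                              dov_plain s (x - n%:Z - (s * n.+1)%N%:Z)) - G n.
  have -> : G n = \sum_(s < n) (G s.+1 - G s).
    rewrite -(big_mkord xpredT (fun s => G s.+1 - G s)) telescope_sumr //.
    by rewrite /G !subr0 subrr mulr0 subr0.
  rewrite -sumrB /gauss_tail -big_split; apply: eq_bigr => s _ /=.
  have := dov_plain_rec s (x - (s.+1 * n)%N%:Z).
  rewrite /G.
  have E1 : x - (s.+1 * n)%N%:Z = x - n%:Z - (s * n)%N%:Z.
    by rewrite mulSn PoszD; ring.
  have E2 : x - (s * n.+1)%N%:Z = x - (s * n)%N%:Z - s%:Z.
    by rewrite mulnS PoszD; ring.
  have E3 : x - n%:Z - (s * n.+1)%N%:Z = x - n%:Z - (s * n)%N%:Z - s%:Z.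
    by rewrite mulnS PoszD; ring.
  rewrite -/n E1 E2 E3 => ->.
  by rewrite exprS; ring.
rewrite /gauss_tail [in LHS]big_ord_recr [X in _ - X]big_ord_recr /=.
rewrite (eq_bigr _ (fun i _ => mulrBr _ _ _)) sumrB /G.
have E1 : x - (n * n.+1)%N%:Z = x - (n * n)%N%:Z - n%:Z.
  by rewrite mulnS PoszD; ring.
have E2 : x - n%:Z - (n * n.+1)%N%:Z = x - (n * n)%N%:Z - (2 * n)%N%:Z.
  by rewrite mulnS PoszD PoszM; ring.
by rewrite -/n E1 E2 expnS expn1; ring.
Qed.

(** Up to degree n the bound n on the parts is no restriction, and in degree n only the summand s =
    0 of [gauss_tail n] survives. *)
Lemma pbar_gauss (n : nat) :
  theta_sum n (zext (fun k => (pbar k)%:Z)) n%:Z = (n == 0%N)%:R.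
Proof.
have pbarE x : (x <= n%:Z) -> zext (fun k => (pbar k)%:Z) x = ov_le n x.
  case: x => //= k; rewrite lez_nat => le_kn.
  by rewrite /ov_le /= count_parts_le_all.
have -> : theta_sum n (zext (fun k => (pbar k)%:Z)) n%:Z = theta_sum n (ov_le n) n%:Z.
  rewrite /theta_sum pbarE //; congr (_ + _ * _).
  by apply: eq_bigr => i _; rewrite pbarE //; lia.
rewrite theta_sum_ov_le /gauss_tail big_ord_recl big1 => [|i _].
  rewrite addr0 expr0 mul1r.
  change (dov_plain 0 (n%:Z - (0 * n.+1)%N%:Z) = (n == 0%N)%:R).
  by rewrite mul0n subr0.
by rewrite lift0 dov_plain_lt0 ?mulr0 // mulSn; nia.
Qed.
(** * Chebyshev polynomials at equidistant nodes *)

Fixpoint cheb (R : pzRingType) (n : nat) (x : R) : R :=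
  match n with
  | 0 => 1
  | n'.+1 => match n' with 0 => x | n''.+1 => 2 * x * cheb n' x - cheb n'' x end
  end.
Arguments cheb : simpl never.

Lemma cheb0 (R : pzRingType) (x : R) : cheb 0 x = 1.
Proof. by []. Qed.

Lemma cheb1 (R : pzRingType) (x : R) : cheb 1 x = x.
Proof. by []. Qed.

Lemma chebSS (R : pzRingType) n (x : R) :
  cheb n.+2 x = 2 * x * cheb n.+1 x - cheb n x.
Proof. by []. Qed.

Lemma nat_ind2 (P : nat -> Prop) :
  P 0%N -> P 1%N -> (forall n, P n -> P n.+1 -> P n.+2) -> forall n, P n.
Proof.
move=> P0 P1 PSS n; suff: P n /\ P n.+1 by case.
by elim: n => // n [Pn PSn]; split=> //; apply: PSS.
Qed.

Section ChebyshevNodes.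
Variable R : realType.
Implicit Types (x y e : R) (n i k M : nat).

Lemma cosM_prod x y : 2 * cos x * cos y = cos (x + y) + cos (x - y).
Proof. by rewrite cosD cosB; ring. Qed.

Lemma cos_natSS n x : cos (n.+2%:R * x) = 2 * cos x * cos (n.+1%:R * x) - cos (n%:R * x).
Proof.
rewrite cosM_prod (_ : x + _ = n.+2%:R * x); last by rewrite -!natr1; ring.
by rewrite (_ : x - _ = - (n%:R * x)) ?cosN ?addrK // -!natr1; ring.
Qed.

Lemma cheb_cos n x : cheb n (cos x) = cos (n%:R * x).
Proof.
elim/nat_ind2: n => [||n IH0 IH1]; rewrite ?mul0r ?cos0 ?mul1r //.
by rewrite chebSS IH0 IH1 cos_natSS.
Qed.

Lemma cos_natpi k x : cos (k%:R * pi + x) = (-1) ^+ k * cos x.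
Proof.
elim: k => [|k IHk]; first by rewrite mul0r add0r mul1r.
by rewrite -natr1 mulrDl mul1r addrAC cosDpi IHk exprS; ring.
Qed.

Lemma sin_natpi k : sin (k%:R * pi) = 0 :> R.
Proof.
elim: k => [|k IHk]; first by rewrite mul0r sin0.
by rewrite -natr1 mulrDl mul1r sinDpi IHk oppr0.
Qed.

Definition node M k : R := k%:R * pi / M%:R.

(** Multiplication by 2 sin h, with h half the angular step, makes the sum telescope. *)
Lemma sum_cos_node M i : (0 < i < 2 * M)%N ->
  \sum_(k < 2 * M) cos (i%:R * node M k) = 0.
Proof.
move=> /andP[i_gt0 lt_i2M].
have M_gt0 : 0 < M%:R :> R by rewrite ltr0n; lia.
pose h : R := i%:R * pi / (2 * M%:R).
have sinh_neq0 : sin h != 0.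
  rewrite gt_eqF // sin_gt0_pi // /h.
  have pi0 := pi_gt0 R.
  have M2_gt0 : 0 < 2 * M%:R :> R by rewrite mulr_gt0.
  apply/andP; split; first by rewrite !mulr_gt0 ?invr_gt0 ?ltr0n.
  by rewrite ltr_pdivrMr // mulrC ltr_pM2l // -natrM ltr_nat.
have E k : 2 * sin h * cos (i%:R * node M k) =
    sin (k.+1%:R * (2 * h) - h) - sin (k%:R * (2 * h) - h).
  have -> : i%:R * node M k = k%:R * (2 * h).
    by rewrite /node /h; field; rewrite gt_eqF.
  have -> : k.+1%:R * (2 * h) - h = k%:R * (2 * h) + h by rewrite -natr1; ring.
  by rewrite sinD sinB; ring.
apply/(@mulfI _ (2 * sin h)); first by rewrite mulf_neq0 ?pnatr_eq0.
rewrite mulr0 mulr_sumr; under eq_bigr => k _ do rewrite E.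
rewrite -(big_mkord xpredT (fun k => sin (k.+1%:R * (2 * h) - h)
                                     - sin (k%:R * (2 * h) - h))).
rewrite telescope_sumr // mul0r sub0r.
have -> : (2 * M)%:R * (2 * h) - h = - h + (2 * i)%:R * pi.
  by rewrite /h !natrM; field; rewrite gt_eqF.
rewrite sinD sin_natpi mulr0 addr0.
by rewrite -[_ * pi]addr0 cos_natpi cos0 mulr1 exprM sqrrN expr1n expr1n mulr1 subrr.
Qed.

(** Since (-1)^k = cos (M t) at the node t = [node M k], where sin (M t) = 0, the weight is cos ((M
    - i) t). The sum is thus an unnormalised Fourier coefficient, at frequency M - i, of the cosine
    polynomial [cheb n (cos t + e)], which is cos (n t) + 2 n e cos ((n - 1) t) plus lower
    frequencies. It vanishes for n < M - i, and the two top coefficients give the cases n + i = M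
    and n + i = M + 1. *)
Definition node_sum M e n i : R :=
  \sum_(k < 2 * M) (-1) ^+ k * cos (i%:R * node M k) * cheb n (cos (node M k) + e).

Lemma cos_node_M M k : (0 < M)%N -> cos (M%:R * node M k) = (-1) ^+ k.
Proof.
move=> M_gt0.
have -> : M%:R * node M k = k%:R * pi + 0.
  by rewrite /node; field; rewrite pnatr_eq0 -lt0n.
by rewrite cos_natpi cos0 mulr1.
Qed.

Lemma node_sum0 M e i : (i < M)%N -> node_sum M e 0 i = 0.
Proof.
move=> lt_iM; have M_gt0 : (0 < M)%N by lia.
apply/(@mulfI _ 2); rewrite ?pnatr_eq0 // mulr0 mulr_sumr.
rewrite (eq_bigr (fun k : 'I_(2 * M) => cos ((M + i)%:R * node M k)
                                 + cos ((M - i)%:R * node M k))) => [|k _].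
  by rewrite big_split /= !sum_cos_node ?addr0 //; lia.
rewrite -(cos_node_M k M_gt0) mulr1 mulrA cosM_prod natrD natrB 1?ltnW //.
by rewrite mulrDl mulrBl.
Qed.

Lemma node_sum0M M e : (0 < M)%N -> node_sum M e 0 M = (2 * M)%:R.
Proof.
move=> M_gt0; rewrite /node_sum (eq_bigr (fun=> 1)) => [|k _].
  by rewrite sumr_const card_ord.
by rewrite cos_node_M // mulr1 -exprMn mulrNN mulr1 expr1n.
Qed.

(** At the nodes the frequencies M + 1 and M - 1 coincide. *)
Lemma node_sum0MS M e : (1 < M)%N -> node_sum M e 0 M.+1 = 0.
Proof.
case: M => // M M_gt0; rewrite -(@node_sum0 M.+1 e M) //.
apply: eq_bigr => k _; congr (_ * _ * _).
rewrite cos_natSS cos_node_M //.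
suff <- : cos (node M.+1 k) * (-1) ^+ k = cos (M%:R * node M.+1 k) by ring.
rewrite -(cos_node_M k (ltn0Sn M)) -cosN.
have -> : M%:R * node M.+1 k = M.+1%:R * node M.+1 k - node M.+1 k.
  by rewrite -natr1; ring.
have -> : M.+1%:R * node M.+1 k = k%:R * pi.
  by rewrite /node mulrC divfK ?pnatr_eq0.
by rewrite cos_natpi -[k%:R * pi]addr0 cos_natpi cos0; ring.
Qed.

Lemma node_sumSS M e n i :
  node_sum M e n.+2 i.+1 = node_sum M e n.+1 i.+2 + node_sum M e n.+1 i
    + 2 * e * node_sum M e n.+1 i.+1 - node_sum M e n i.+1.
Proof.
rewrite /node_sum mulr_sumr -!big_split -sumrB /=; apply: eq_bigr => k _.
by rewrite chebSS cos_natSS; ring.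
Qed.

Lemma node_sum1 M e i :
  2 * node_sum M e 1 i.+1 = node_sum M e 0 i.+2 + node_sum M e 0 i
    + 2 * e * node_sum M e 0 i.+1.
Proof.
rewrite /node_sum !mulr_sumr -!big_split /=; apply: eq_bigr => k _.
by rewrite cos_natSS cheb0 cheb1; ring.
Qed.

Lemma node_sumS0 M e n :
  node_sum M e n.+2 0 = 2 * node_sum M e n.+1 1
    + 2 * e * node_sum M e n.+1 0 - node_sum M e n 0.
Proof.
rewrite /node_sum !mulr_sumr -!big_split -sumrB /=; apply: eq_bigr => k _.
by rewrite chebSS mul0r cos0 mul1r; ring.
Qed.

Lemma node_sum10 M e : node_sum M e 1 0 = node_sum M e 0 1 + e * node_sum M e 0 0.
Proof.
rewrite /node_sum !mulr_sumr -!big_split /=; apply: eq_bigr => k _.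
by rewrite mul0r cos0 mul1r cheb0 cheb1; ring.
Qed.

Lemma node_sum_lt M e n i : (n + i < M)%N -> node_sum M e n i = 0.
Proof.
elim/nat_ind2: n i => [i|[|i] lt_M|n IH0 IH1 [|i] lt_M]; first exact: node_sum0.
- by rewrite node_sum10 !node_sum0 ?mulr0 ?addr0 //; lia.
- apply/(@mulfI _ 2); first by rewrite pnatr_eq0.
  by rewrite node_sum1 !node_sum0 ?mulr0 ?addr0 //; lia.
- by rewrite node_sumS0 !IH1 ?IH0 ?mulr0 ?addr0 ?subr0 //; lia.
by rewrite node_sumSS !IH1 ?IH0 ?mulr0 ?addr0 ?subr0 //; lia.
Qed.

Lemma node_sum_eq M e n i :
  (n.+1 + i.+1 = M)%N -> node_sum M e n.+1 i.+1 = M%:R.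
Proof.
elim: n i => [|n IHn] i def_M.
  apply/(@mulfI _ 2); first by rewrite pnatr_eq0.
  rewrite node_sum1 (_ : i.+2 = M); last by lia.
  by rewrite node_sum0M ?node_sum0 ?natrM ?mulr0 ?addr0 //; lia.
rewrite node_sumSS IHn; last by lia.
by rewrite !node_sum_lt ?mulr0 ?addr0 ?subr0 //; lia.
Qed.

Lemma node_sum_eqS M e n i : (1 < M)%N ->
  (n.+1 + i.+1 = M.+1)%N -> node_sum M e n.+1 i.+1 = (2 * n.+1 * M)%:R * e.
Proof.
move=> M_gt1; elim: n i => [|n IHn] i def_M.
  apply/(@mulfI _ 2); first by rewrite pnatr_eq0.
  rewrite node_sum1 (_ : i.+1 = M); last by lia.
  rewrite node_sum0M ?node_sum0MS ?node_sum0 ?natrM ?add0r ?mulr1; [|lia..].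
  by ring.
rewrite node_sumSS IHn; last by lia.
rewrite (@node_sum_lt M e n.+1 i) ?(@node_sum_lt M e n i.+1) ?node_sum_eq; [|lia..].
by rewrite !natrM -[n.+2%:R]natr1; ring.
Qed.

Lemma node_sum_M0 M e : (1 < M)%N -> node_sum M e M 0 = (2 * M)%:R.
Proof.
case: M => [|[|M]] // _; rewrite node_sumS0 node_sum_eq ?addn1 //.
by rewrite !node_sum_lt ?mulr0 ?addr0 ?subr0 ?natrM //; lia.
Qed.

(** Without the weight 1 + cos t the terms sum to [node_sum M e M 0] - 2 M = 0, an identity empty of
    information: the nodes near pi offset those near 0. The weight is 2 at t = 0 and vanishes at t =
    pi, so it isolates the nodes near 0, and its cosine brings in the coefficient proportional to
    e. *)
Definition cheb_term M e k : R :=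
  (1 + cos (node M k)) * ((-1) ^+ k * cheb M (cos (node M k) + e) - 1).

Lemma sum_cheb_term2 M e : (1 < M)%N ->
  \sum_(k < 2 * M) cheb_term M e k = 2 * M%:R ^+ 2 * e.
Proof.
move=> M_gt1.
have -> : \sum_(k < 2 * M) cheb_term M e k =
    node_sum M e M 0 + node_sum M e M 1
    - (\sum_(k < 2 * M) 1 + \sum_(k < 2 * M) cos (1%:R * node M k)).
  rewrite /node_sum -!big_split -sumrB /=; apply: eq_bigr => k _.
  by rewrite /cheb_term mul0r cos0 mul1r; ring.
rewrite node_sum_M0 // sum_cos_node ?addr0; last by lia.
rewrite sumr_const card_ord.
case: M M_gt1 => // M M_gt1; rewrite node_sum_eqS ?addn1 //.
by rewrite !natrM; ring.
Qed.

Lemma cheb_term_sym M e k : (0 < M)%N -> (k <= 2 * M)%N ->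
  cheb_term M e (2 * M - k) = cheb_term M e k.
Proof.
move=> M_gt0 le_k; have M_neq0 : M%:R != 0 :> R by rewrite pnatr_eq0 -lt0n.
have -> : cheb_term M e (2 * M - k) =
    (1 + cos (node M (2 * M - k))) *
    ((-1) ^+ k * cheb M (cos (node M (2 * M - k)) + e) - 1).
  rewrite /cheb_term; congr (_ * (_ * _ - _)).
  by rewrite -[LHS]signr_odd -[RHS]signr_odd oddB // oddM.
suff -> : cos (node M (2 * M - k)) = cos (node M k) by [].
have -> : node M (2 * M - k) = 2%:R * pi + - node M k.
  by rewrite /node natrB // natrM; field.
by rewrite cos_natpi cosN sqrrN expr1n mul1r.
Qed.

Lemma sum_cheb_term M e : (1 < M)%N ->
  cheb M (1 + e) - 1 + \sum_(1 <= k < M) cheb_term M e k = M%:R ^+ 2 * e.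
Proof.
move=> M_gt1; have M_gt0 := ltnW M_gt1.
have M_neq0 : M%:R != 0 :> R by rewrite pnatr_eq0 -lt0n.
apply/(@mulfI _ 2); first by rewrite pnatr_eq0.
rewrite [RHS]mulrA -sum_cheb_term2 // -(big_mkord xpredT (cheb_term M e)).
rewrite [RHS](@big_cat_nat _ _ _ M) //=; last by lia.
rewrite [X in _ = X + _]big_ltn // [X in _ = _ + X]big_ltn; last by lia.
have -> : cheb_term M e M = 0.
  rewrite /cheb_term /node mulrAC mulfV // mul1r cospi.
  by rewrite subrr mul0r.
have -> : cheb_term M e 0 = 2 * (cheb M (1 + e) - 1).
  by rewrite /cheb_term /node !mul0r cos0 mul1r; ring.
have -> : \sum_(M.+1 <= k < 2 * M) cheb_term M e k =
          \sum_(1 <= k < M) cheb_term M e k.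
  rewrite [RHS]big_nat_rev [RHS]big_add1 -[M.+1]add0n big_addn.
  rewrite (_ : (2 * M - M.+1 = M.-1)%N); last by lia.
  apply: eq_big_nat => j /andP[_ lt_j].
  by rewrite -cheb_term_sym //; [congr cheb_term|]; lia.
by rewrite add0r; ring.
Qed.

End ChebyshevNodes.
(** * The theta sum of cosh (sqrt z) *)

Section CoshSqrt.
Variable R : realType.
Implicit Types (x y z t u v w r : R) (n M : nat).

Lemma cvg_near_eq (f g : nat -> R) (l : R) :
  (\forall n \near \oo, f n = g n)%classic ->
  (g n @[n --> \oo] --> l)%classic -> (f n @[n --> \oo] --> l)%classic.
Proof.
move=> fg; apply: cvg_trans; apply: near_eq_cvg.
by apply: filterS fg => n ->.
Qed.

Lemma cvg_dist_le (f g : nat -> R) (l : R) :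
  (\forall n \near \oo, `|f n - l| <= g n)%classic ->
  (g n @[n --> \oo] --> 0)%classic -> (f n @[n --> \oo] --> l)%classic.
Proof.
move=> fg g0; apply/subr_cvg0; apply/norm_cvg0P.
apply: (@squeeze_cvgr _ _ _ _ (fun=> 0) g) => //; last exact: cvg_cst.
by apply: filterS fg => n ->; rewrite normr_ge0.
Qed.

Lemma cvg_slope (g : R -> R) (d w : R) :
  g 0 = 0 -> is_derive (0 : R) 1 g d ->
  (n%:R * g (w / n%:R) @[n --> \oo] --> w * d)%classic.
Proof.
move=> g0 dg; rewrite -(cvg_shiftS (fun n => n%:R * g (w / n%:R))).
have dh : is_derive (0 : R) 1 (g \o (fun t => w * t)) (d * w).
  apply: is_derive1_comp; first by rewrite mulr0.
  by apply: is_derive_eq; rewrite scaler1.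
have [hd E] := dh.
have H : ((fun h => h^-1 *: ((g \o (fun t => w * t)) (h *: 1 + 0) -
     (g \o (fun t => w * t)) 0)) x @[x --> 0^'] --> d * w)%classic.
  by rewrite -E; exact: hd.
have := (cvg_at_rightP _ _ _).1 (cvg_dnbhs_at_right H) (fun n => n.+1%:R^-1).
rewrite [w * d]mulrC => /(_ _)/wrap[].
  split=> [n|]; first by rewrite invr_gt0.
  exact: cvg_harmonic.
apply: cvg_trans; apply: near_eq_cvg; apply: nearW => n /=.
by rewrite invrK mulr0 g0 subr0 addr0 /GRing.scale /= mulr1.
Qed.

Definition cosh t : R := (expR t + expR (- t)) / 2.

Lemma cheb_cosh n t : cheb n (cosh t) = cosh (n%:R * t).
Proof.
have E2 u v : 2 * cosh u * cosh v = cosh (u + v) + cosh (u - v).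
  by rewrite /cosh opprD opprB !expRD; field.
elim/nat_ind2: n => [||n IH0 IH1]; rewrite ?cheb0 ?cheb1 ?mul1r //.
  by rewrite mul0r /cosh oppr0 expR0; field.
rewrite chebSS IH0 IH1 E2.
have -> : t + n.+1%:R * t = n.+2%:R * t by rewrite -!natr1; ring.
have -> : t - n.+1%:R * t = - (n%:R * t) by rewrite -!natr1; ring.
by rewrite /cosh opprK; ring.
Qed.

Lemma coshB1 t : cosh t - 1 = (expR (t / 2) - expR (- (t / 2))) ^+ 2 / 2.
Proof.
have E (u : R) : expR u = expR (u / 2) ^+ 2 by rewrite expr2 -expRD; congr expR; field.
rewrite /cosh (E t) (E (- t)) mulNr.
have : expR (t / 2) * expR (- (t / 2)) = 1 by rewrite -expRD subrr expR0.
by set a := expR _; set b := expR _ => H; rewrite -[X in _ - X]H; field.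
Qed.

(** The constant is 8 and not 2 because e^(t/2) - e^(-t/2) is only bounded below by t/2. Any
    quadratic lower bound serves. *)
Lemma cosh_ge t : 0 <= t -> 1 + t ^+ 2 / 8 <= cosh t.
Proof.
move=> t_ge0; rewrite -lerBrDl coshB1.
have h1 : 1 + t / 2 <= expR (t / 2) by exact: expR_ge1Dx.
have h2 : expR (- (t / 2)) <= 1 by rewrite expR_le1; lra.
have : (t / 2) ^+ 2 <= (expR (t / 2) - expR (- (t / 2))) ^+ 2.
  by rewrite ler_sqr ?nnegrE; lra.
by rewrite expr_div_n; lra.
Qed.

Lemma cosh_ge1 t : 1 <= cosh t.
Proof. by rewrite -subr_ge0 coshB1 divr_ge0 ?sqr_ge0. Qed.

(* [chsqrt] is the entire function cosh (sqrt z), restricted to the reals. *)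
Definition chsqrt z : R :=
  if 0 <= z then cosh (Num.sqrt z) else cos (Num.sqrt (- z)).

Lemma cheb_chsqrt M z : (0 < M)%N -> cheb M (chsqrt (z / M%:R ^+ 2)) = chsqrt z.
Proof.
move=> M_gt0; have M0 : 0 < M%:R :> R by rewrite ltr0n.
rewrite /chsqrt pmulr_lge0 ?invr_gt0 ?exprn_gt0 //.
have E y : 0 <= y -> M%:R * Num.sqrt (y / M%:R ^+ 2) = Num.sqrt y.
  move=> y_ge0; rewrite sqrtrM // sqrtrV ?sqr_ge0 // sqrtr_sqr gtr0_norm //.
  by field; rewrite gt_eqF.
case: ifP => z0; first by rewrite cheb_cosh E.
by rewrite cheb_cos -mulNr E // oppr_ge0 ltW // ltNge z0.
Qed.

(* The increments of [cheb n (1 + u)] in [n] satisfy a recurrence with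
   nonnegative coefficients, hence the majorant at [r = |u|]. *)
Lemma cheb_majorant r u n : `|u| <= r ->
  `|cheb n (1 + u)| <= cheb n (1 + r) /\
  `|cheb n.+1 (1 + u) - cheb n (1 + u)| <= cheb n.+1 (1 + r) - cheb n (1 + r).
Proof.
move=> le_ur; elim: n => [|n [IH1 IH2]].
  rewrite !cheb0 !cheb1 normr1; split=> //.
  by rewrite addrAC subrr add0r addrAC subrr add0r.
have H : `|cheb n.+1 (1 + u)| <= cheb n.+1 (1 + r).
  rewrite -[cheb n.+1 (1 + u)](subrK (cheb n (1 + u))).
  by apply: le_trans (ler_normD _ _) _; lra.
split=> //; rewrite !chebSS.
have -> : 2 * (1 + u) * cheb n.+1 (1 + u) - cheb n (1 + u) - cheb n.+1 (1 + u) =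
  (cheb n.+1 (1 + u) - cheb n (1 + u)) + 2 * u * cheb n.+1 (1 + u) by ring.
apply: le_trans (ler_normD _ _) _; rewrite !normrM normr_nat.
have : `|u| * `|cheb n.+1 (1 + u)| <= r * cheb n.+1 (1 + r).
  by apply: ler_pM.
by lra.
Qed.

(** A polynomial with nonnegative coefficients in powers of x - 1 has, on |x - 1| <= r, slopes at
    most its mean slope between 1 + r and 1 + 2 r, which is [B n] / r. The induction runs this
    comparison on the increments in n. *)
Lemma cheb_lipschitz r u v n : `|u| <= r -> `|v| <= r ->
  r * `|cheb n (1 + u) - cheb n (1 + v)| <= `|u - v| * cheb n (1 + 2 * r).
Proof.
move=> le_ur le_vr.
have r_ge0 : 0 <= r by exact: le_trans le_ur.
pose B k := cheb k (1 + 2 * r) - cheb k (1 + r).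
pose D k := cheb k (1 + u) - cheb k (1 + v).
have le_r2r : `|r| <= 2 * r by rewrite ger0_norm //; lra.
suff [H _] : r * `|D n| <= `|u - v| * B n /\
             r * `|D n.+1 - D n| <= `|u - v| * (B n.+1 - B n).
  apply: le_trans H _; rewrite ler_wpM2l // lerBlDr lerDl.
  by apply: le_trans (cheb_majorant n le_ur).1; exact: normr_ge0.
elim: n => [|n [IH1 IH2]].
  rewrite /D /B !cheb0 !cheb1 !subrr normr0 !mulr0; split=> //.
  rewrite !subr0 (_ : 1 + u - (1 + v) = u - v); last by ring.
  by rewrite (_ : 1 + 2 * r - (1 + r) = r) 1?mulrC //; ring.
have H : r * `|D n.+1| <= `|u - v| * B n.+1.
  rewrite -[D n.+1](subrK (D n)).
  apply: le_trans (_ : r * (`|D n.+1 - D n| + `|D n|) <= _).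
    by rewrite ler_wpM2l // ler_normD.
  by rewrite mulrDr; lra.
split=> //.
have -> : D n.+2 - D n.+1 = (D n.+1 - D n) +
    (2 * (u - v) * cheb n.+1 (1 + u) + 2 * v * D n.+1).
  by rewrite /D !chebSS; ring.
have -> : B n.+2 - B n.+1 = (B n.+1 - B n) +
    (4 * r * cheb n.+1 (1 + 2 * r) - 2 * r * cheb n.+1 (1 + r)).
  by rewrite /B !chebSS; ring.
apply: le_trans (_ : r * (`|D n.+1 - D n| +
    (2 * `|u - v| * `|cheb n.+1 (1 + u)| + 2 * `|v| * `|D n.+1|)) <= _).
  rewrite ler_wpM2l //; apply: le_trans (ler_normD _ _) _; rewrite lerD2l.
  by apply: le_trans (ler_normD _ _) _; rewrite !normrM normr_nat.
have uv0 := normr_ge0 (u - v).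
have mu := (cheb_majorant n.+1 le_ur).1.
have mr : cheb n.+1 (1 + r) <= cheb n.+1 (1 + 2 * r).
  by apply: le_trans (cheb_majorant n.+1 le_r2r).1; exact: ler_norm.
rewrite mulrDr [in X in _ <= X]mulrDr; apply: lerD => //.
have h1 : `|u - v| * `|cheb n.+1 (1 + u)| <= `|u - v| * cheb n.+1 (1 + r).
  by rewrite ler_wpM2l.
have h2 : `|u - v| * cheb n.+1 (1 + r) <= `|u - v| * cheb n.+1 (1 + 2 * r).
  by rewrite ler_wpM2l.
have h3 : `|v| * (r * `|D n.+1|) <= r * (`|u - v| * B n.+1).
  by apply: ler_pM => //; rewrite mulr_ge0.
have h1' : r * (`|u - v| * `|cheb n.+1 (1 + u)|) <= r * (`|u - v| * cheb n.+1 (1 + r)).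
  by rewrite ler_wpM2l.
have h2' : r * (`|u - v| * cheb n.+1 (1 + r)) <= r * (`|u - v| * cheb n.+1 (1 + 2 * r)).
  by rewrite ler_wpM2l.
rewrite /B in h3.
have -> : r * (2 * `|u - v| * `|cheb n.+1 (1 + u)| + 2 * `|v| * `|D n.+1|) =
   2 * (r * (`|u - v| * `|cheb n.+1 (1 + u)|)) + 2 * (`|v| * (r * `|D n.+1|)) by ring.
have -> : `|u - v| * (4 * r * cheb n.+1 (1 + 2 * r) - 2 * r * cheb n.+1 (1 + r)) =
   4 * (r * (`|u - v| * cheb n.+1 (1 + 2 * r))) -
   2 * (r * (`|u - v| * cheb n.+1 (1 + r))) by ring.
by lra.
Qed.

(** At cosh (w / M) the majorant [cheb M] equals cosh w, whatever M is. *)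
Lemma cheb_le_cosh M u w : (0 < M)%N -> 0 <= w ->
  `|u| <= w ^+ 2 / (8 * M%:R ^+ 2) -> `|cheb M (1 + u)| <= cosh w.
Proof.
move=> M_gt0 w0 le_u; have M0 : 0 < M%:R :> R by rewrite ltr0n.
have cw : 1 + w ^+ 2 / (8 * M%:R ^+ 2) <= cosh (w / M%:R).
  apply: le_trans (cosh_ge _); last by rewrite divr_ge0 // ltW.
  by rewrite le_eqVlt; apply/orP; left; apply/eqP; field; rewrite gt_eqF.
have le_u' : `|u| <= cosh (w / M%:R) - 1 by lra.
apply: le_trans (cheb_majorant M le_u').1 _.
by rewrite addrC subrK cheb_cosh mulrCA divff ?mulr1 // gt_eqF.
Qed.

Lemma cvg_chsqrt1 z :
  (n%:R ^+ 2 * 2 * (chsqrt (z / n%:R ^+ 2) - 1) @[n --> \oo] --> z)%classic.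
Proof.
have sqE y n : 0 <= y -> (0 < n)%N -> Num.sqrt (y / n%:R ^+ 2) = Num.sqrt y / n%:R.
  by move=> y0 n0; rewrite sqrtrM // sqrtrV ?sqr_ge0 // sqrtr_sqr normr_nat.
have sgnE n : (0 < n)%N -> (0 <= z / n%:R ^+ 2) = (0 <= z).
  by move=> n0; rewrite pmulr_lge0 // invr_gt0 exprn_gt0 // ltr0n.
have [z0|z0] := leP 0 z.
  set w := Num.sqrt z.
  pose g t := expR (t / 2) - expR (- (t / 2)).
  have dg : is_derive (0 : R) 1 g 1.
    rewrite /g; apply: is_derive_eq.
    by rewrite /GRing.scale /= !mul0r oppr0 expR0; field.
  have g0 : g 0 = 0 by rewrite /g mul0r oppr0 subrr.
  have Hc := cvg_slope (w := w) g0 dg.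
  rewrite -[X in (_ --> X)%classic](sqr_sqrtr z0) -/w expr2 -{1 2}[w]mulr1.
  apply: cvg_near_eq (cvgM Hc Hc).
  apply: filterS (nbhs_infty_gt 0) => n n0 /=.
  rewrite /chsqrt sgnE // z0 sqE // -/w coshB1 /g.
  by field.
have Nz0 : 0 <= - z by lra.
set w := Num.sqrt (- z).
pose g t : R := 2 * sin (t / 2).
have dg : is_derive (0 : R) 1 g 1.
  rewrite /g; apply: is_derive_eq.
  by rewrite /GRing.scale /= mul0r cos0; field.
have g0 : g 0 = 0 by rewrite /g mul0r sin0 mulr0.
have Hc := cvg_slope (w := w) g0 dg.
rewrite [X in (_ --> X)%classic](_ : z = - (w * 1 * (w * 1))); last first.
  by rewrite mulr1 -expr2 sqr_sqrtr // opprK.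
apply: cvg_near_eq (cvgN (cvgM Hc Hc)).
apply: filterS (nbhs_infty_gt 0) => n n0 /=.
rewrite /chsqrt sgnE // leNgt z0 /= -mulNr sqE // -/w /g.
have -> : cos (w / n%:R) = 1 - 2 * sin (w / n%:R / 2) ^+ 2.
  rewrite {1}(_ : w / n%:R = (w / n%:R / 2) *+ 2); last by rewrite mulr2n; field; rewrite pnatr_eq0 -lt0n.
  by rewrite cos_mulr2n cos2sin2; ring.
by ring.
Qed.

(** The points [y n] satisfy [cheb n (y n) = chsqrt z] exactly. [x n] differs from them by o(1 /
    n^2), while the Lipschitz constant of [cheb n] at that distance from 1 is O(n^2). *)
Lemma cvg_cheb (x : nat -> R) z :
  (n%:R ^+ 2 * 2 * (x n - 1) @[n --> \oo] --> z)%classic ->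
  (cheb n (x n) @[n --> \oo] --> chsqrt z)%classic.
Proof.
move=> hx; pose y n := chsqrt (z / n%:R ^+ 2); have hy := @cvg_chsqrt1 z.
pose C := `|z| + 1; have C0 : 0 < C by rewrite /C; have := normr_ge0 z; lra.
(* With r = C / (2 n^2) below, w^2 / (8 n^2) = 2 r, as [cheb_le_cosh] requires. *)
pose w := Num.sqrt (8 * C).
have zC : `|z| < C by rewrite /C ltrDl.
have hxy := cvgB hx hy.
apply: (@cvg_dist_le _ (fun n => `|n%:R ^+ 2 * 2 * (x n - 1) -
          n%:R ^+ 2 * 2 * (y n - 1)| * (cosh w / C))); last first.
  rewrite -[X in (_ --> X)%classic](mul0r (cosh w / C)); apply: cvgMr_tmp.
  have H0 := cvg_norm (cvgB hx hy); rewrite subrr normr0 in H0; exact: H0.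
near=> n.
have n0 : (0 < n)%N by near: n; exact: nbhs_infty_gt.
have bx : `|n%:R ^+ 2 * 2 * (x n - 1)| <= C.
  by near: n; exact: cvgr_norm_le z hx _ zC.
have by_ : `|n%:R ^+ 2 * 2 * (y n - 1)| <= C.
  by near: n; exact: cvgr_norm_le z hy _ zC.
 have N0 : 0 < n%:R :> R by rewrite ltr0n.
have N2 : 0 < n%:R ^+ 2 :> R by rewrite exprn_gt0.
pose r := C / (n%:R ^+ 2 * 2).
have r0 : 0 < r by rewrite divr_gt0 // mulr_gt0.
have toR u : `|n%:R ^+ 2 * 2 * u| <= C -> `|u| <= r.
  rewrite normrM gtr0_norm ?mulr_gt0 // mulrC => ?.
  by rewrite /r ler_pdivlMr // mulr_gt0.
have := cheb_lipschitz n (toR _ bx) (toR _ by_).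
rewrite !(addrC 1) !subrK -(addrC 1) (cheb_chsqrt z n0) => H.
have H2 : cheb n (1 + 2 * r) <= cosh w.
  apply: le_trans (ler_norm _) _; apply: cheb_le_cosh => //.
    exact: sqrtr_ge0.
  rewrite sqr_sqrtr; last by rewrite mulr_ge0 // ltW.
  rewrite gtr0_norm; last by rewrite mulr_gt0.
  by rewrite [leLHS](_ : _ = 8 * C / (8 * n%:R ^+ 2)) //; rewrite /r; field; rewrite gt_eqF.
rewrite -(ler_pM2l r0); apply: le_trans H _.
rewrite -mulrBr normrM gtr0_norm ?mulr_gt0 //.
have -> : r * (n%:R ^+ 2 * 2 * `|x n - 1 - (y n - 1)| * (cosh w / C)) =
   `|x n - 1 - (y n - 1)| * cosh w.
  by rewrite /r; field; rewrite !gt_eqF.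
by rewrite ler_wpM2l.
Unshelve. all: by end_near. Qed.

End CoshSqrt.

(** * Domination of the Chebyshev terms and the limit of the identity *)

Section ThetaChsqrt.
Variable R : realType.
Implicit Types (x y z t s e : R) (n M k : nat).

Lemma cos_double t : cos t = 2 * cos (t / 2) ^+ 2 - 1.
Proof.
by rewrite {1}(_ : t = (t / 2) *+ 2) ?cos_mulr2n ?mulr2n; [ring|field].
Qed.

Lemma sin_nat_le n t : `|sin (n%:R * t)| <= n%:R * `|sin t|.
Proof.
elim: n => [|n IHn]; first by rewrite !mul0r sin0 normr0.
rewrite -natr1 mulrDl mul1r sinD mulrDl mul1r.
apply: le_trans (ler_normD _ _) _; rewrite !normrM; apply: lerD.
  by apply: le_trans IHn; rewrite ler_piMr // cos_max.
by rewrite ler_piMl // cos_max.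
Qed.

Lemma sin_ge_mul_cos t : 0 <= t <= pi -> t * cos t <= sin t.
Proof.
move=> /andP[t0 tpi].
pose f x := sin x - x * cos x.
have df x : is_derive x 1 f (x * sin x).
  apply: is_derive_eq; rewrite /GRing.scale /=; ring.
suff : f 0 <= f t by rewrite /f sin0 mul0r subrr; lra.
have f'E x : f^`()%classic x = x * sin x by rewrite derive1E; apply: derive_val.
apply: (@ger0_derive1_le_cc _ f 0 t) => //.
- move=> x; rewrite in_itv /= f'E => /andP[x0 xt]; apply: mulr_ge0; first exact: ltW.
  by apply: sin_ge0_pi; rewrite ltW // (le_trans (ltW xt)).
- apply: derivable_within_continuous => x _.
  have [+ _] := df x; exact.
- by rewrite in_itv /= lexx.
by rewrite in_itv /= lexx t0.
Qed.

Lemma sin_ge_half t : 0 <= t <= pi / 2 -> t / 2 <= sin t.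
Proof.
move=> /andP[t0 tpi]; have pi0 := pi_gt0 R.
have c0 : 0 <= cos t by apply: cos_ge0_pihalf; apply/andP; split; lra.
have c2 : 0 <= cos (t / 2) by apply: cos_ge0_pihalf; apply/andP; split; lra.
have := @sin_ge_mul_cos (t / 2); rewrite (_ : 0 <= t / 2 <= pi); last first.
  by apply/andP; split; lra.
move=> /(_ isT) h; have hc := cos_double t.
have -> : sin t = 2 * (cos (t / 2) * sin (t / 2)).
  by rewrite {1}(_ : t = (t / 2) *+ 2) ?sin_mulr2n ?mulr2n; [ring|field].
have h2 : cos (t / 2) * (t / 2 * cos (t / 2)) <= cos (t / 2) * sin (t / 2).
  by rewrite ler_wpM2l.
have h3 : t / 2 * (1 / 2) <= t / 2 * cos (t / 2) ^+ 2.
  by rewrite ler_wpM2l //; lra.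
have e1 : cos (t / 2) * (t / 2 * cos (t / 2)) = t / 2 * cos (t / 2) ^+ 2 by ring.
by lra.
Qed.

(** One summand of sin a cos b + cos a sin b suffices: the second if a <= b, the first otherwise.
    The bound does not involve b. *)
Lemma sinD_ge a b : 0 <= a <= pi / 2 -> 0 <= b <= pi / 2 ->
  sin a * cos a <= sin (a + b) :> R.
Proof.
move=> /andP[a0 api] /andP[b0 bpi]; have pi0 := pi_gt0 R.
have ca : 0 <= cos a by apply: cos_ge0_pihalf; apply/andP; split; lra.
have cb : 0 <= cos b by apply: cos_ge0_pihalf; apply/andP; split; lra.
have sa : 0 <= sin a by apply: sin_ge0_pi; apply/andP; split; lra.
have sb : 0 <= sin b by apply: sin_ge0_pi; apply/andP; split; lra.
rewrite sinD; have [ab|ba] := leP a b.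
  have h : sin a <= sin b.
    rewrite leNgt ltr_sin ?in_itv /=; first by rewrite -leNgt.
      by apply/andP; split; lra.
    by apply/andP; split; lra.
  have : sin a * cos a <= cos a * sin b by rewrite mulrC ler_wpM2l.
  by have := mulr_ge0 sa cb; lra.
have h : cos a <= cos b.
  rewrite leNgt ltr_cos ?in_itv /=; first by rewrite -leNgt ltW.
    by apply/andP; split; lra.
  by apply/andP; split; lra.
have : sin a * cos a <= sin a * cos b by rewrite ler_wpM2l.
by have := mulr_ge0 ca sb; lra.
Qed.

Lemma chebN n x : cheb n (- x) = (-1) ^+ n * cheb n x.
Proof.
elim/nat_ind2: n => [||n IH0 IH1]; rewrite ?cheb0 ?cheb1 ?expr0 ?expr1 ?mul1r ?mulN1r //.
by rewrite !chebSS IH0 IH1 !exprS; ring.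
Qed.

Lemma half_node_bounds M k : (k <= M)%N -> (0 < M)%N ->
  0 <= node R M k / 2 <= pi / 2.
Proof.
move=> le_k M0; have M_gt0 : 0 < M%:R :> R by rewrite ltr0n.
have pi0 := pi_gt0 R; rewrite /node; apply/andP; split.
  by rewrite !divr_ge0 ?mulr_ge0 ?pi_ge0.
by rewrite ler_pM2r ?invr_gt0 // ler_pdivrMr // mulrC ler_pM2l // ler_nat.
Qed.

(** The two summands serve the two possible positions of cos t + e in [cheb_term_le]: in [-1, 1],
    and below -1. *)
Definition term_const s : R :=
  4 * pi ^+ 2 * s ^+ 2 + pi ^+ 2 * `|s| * (cosh (2 * pi * Num.sqrt `|s|) + 1).

(** The bound is independent of M and summable in k, so the limit M -> oo may be taken term by
    term. *)
Lemma cheb_term_le M s k : (0 < k < M)%N -> 4 * `|s| <= k%:R ^+ 2 ->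
  `|cheb_term M (pi ^+ 2 * s / (2 * M%:R ^+ 2)) k| <= term_const s / k%:R ^+ 2.
Proof.
move=> /andP[k0 kM] s_le; have M0 : (0 < M)%N by lia.
have M_gt0 : 0 < M%:R :> R by rewrite ltr0n.
have k_gt0 : 0 < k%:R :> R by rewrite ltr0n.
have M2 : 0 < M%:R ^+ 2 :> R by rewrite exprn_gt0.
have k2 : 0 < k%:R ^+ 2 :> R by rewrite exprn_gt0.
have pi0 := pi_gt0 R.
set e := pi ^+ 2 * s / _; set ph := node R M k.
have Me : M%:R ^+ 2 * e = pi ^+ 2 * s / 2.
  by rewrite /e; field; rewrite gt_eqF.
have phE : M%:R * ph = k%:R * pi by rewrite /ph /node; field; rewrite gt_eqF.
have bph : 0 <= ph / 2 <= pi / 2 by apply: half_node_bounds => //; exact: ltnW.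
have sin_ph := sin_ge_half bph.
have ph0 : 0 < ph by rewrite /ph /node !mulr_gt0 ?invr_gt0.
have ph_le : ph <= pi by move/andP: bph => [_]; lra.
have cph : 0 <= cos (ph / 2).
  by apply: cos_ge0_pihalf; move/andP: bph => [? ?]; apply/andP; split; lra.
have cos_ph := cos_double ph; have cs2 := cos2Dsin2 (ph / 2).
have sin2_ge : ph ^+ 2 / 16 <= sin (ph / 2) ^+ 2.
  have : (ph / 4) ^+ 2 <= sin (ph / 2) ^+ 2 by rewrite ler_sqr ?nnegrE; lra.
  by rewrite expr_div_n; lra.
have ph2E : M%:R ^+ 2 * ph ^+ 2 = k%:R ^+ 2 * pi ^+ 2 by rewrite -!exprMn phE.
have pi2 : 0 < pi ^+ 2 :> R by rewrite exprn_gt0.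
have cosh0 := cosh_ge1 (2 * pi * Num.sqrt `|s|).
rewrite ler_pdivlMr // /cheb_term -/ph.
(* A value above 1 is impossible: cos ph <= 1 - ph^2 / 8 would force e > ph^2 / 8, that is 4 s >
   k^2. *)
have [le1|gt1] := leP (cos ph + e) 1; last first.
  exfalso.
  have : M%:R ^+ 2 * (ph ^+ 2 / 8) < M%:R ^+ 2 * e by rewrite ltr_pM2l //; lra.
  rewrite Me mulrA ph2E.
  have : pi ^+ 2 * (4 * `|s|) <= pi ^+ 2 * k%:R ^+ 2 by rewrite ler_pM2l.
  have : pi ^+ 2 * s <= pi ^+ 2 * `|s| by rewrite ler_pM2l // ler_norm.
  by lra.
(* With cos th = cos ph + e and D = (ph - th) / 2, the term is - 4 cos(ph/2)^2 sin(M D)^2. Here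
   |sin(M D)| <= M |sin D|, and e = 2 sin((ph + th)/2) sin D bounds sin D from above, because
   [sinD_ge] bounds the other sine below by sin(ph/2) cos(ph/2). *)
have [geN1|ltN1] := leP (-1) (cos ph + e).
  set th := acos (cos ph + e).
  have xb : -1 <= cos ph + e <= 1 by rewrite geN1.
  have thE : cos th = cos ph + e by rewrite acosK ?in_itv.
  have th0 := acos_ge0 xb; have thpi := acos_lepi xb.
  rewrite -/th in th0 thpi.
  have -> : (-1) ^+ k * cheb M (cos ph + e) = cos (M%:R * (ph - th)).
    rewrite -thE cheb_cos mulrBr phE cosB sin_natpi mul0r addr0.
    by rewrite -[k%:R * pi]addr0 cos_natpi cos0 mulr1.
  have -> : 1 + cos ph = 2 * cos (ph / 2) ^+ 2 by rewrite cos_ph; ring.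
  rewrite (cos_double (M%:R * _)).
  have E1 : M%:R * (ph - th) / 2 = M%:R * ((ph - th) / 2) by ring.
  rewrite E1; set D := (ph - th) / 2.
  have csD := cos2Dsin2 (M%:R * D).
  have -> : 2 * cos (M%:R * D) ^+ 2 - 1 - 1 = - (2 * sin (M%:R * D) ^+ 2) by lra.
  rewrite mulrN normrN ger0_norm; last by do ?[exact: sqr_ge0|exact: normr_ge0|apply: mulr_ge0].
  have hs : sin (M%:R * D) ^+ 2 <= M%:R ^+ 2 * sin D ^+ 2.
    rewrite -exprMn -(real_normK (num_real (sin _))) -(real_normK (num_real (M%:R * _))) normrM normr_nat.
    by rewrite ler_sqr ?nnegrE ?mulr_ge0 ?ler0n // sin_nat_le.
  have hS : sin (ph / 2) * cos (ph / 2) <= sin (ph / 2 + th / 2).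
    by apply: sinD_ge => //; apply/andP; split; lra.
  have eE : e = 2 * (sin (ph / 2 + th / 2) * sin D).
    have : cos (ph / 2 + th / 2 - D) - cos (ph / 2 + th / 2 + D) =
        2 * (sin (ph / 2 + th / 2) * sin D) by set P := ph / 2 + _; rewrite cosB (cosD P); ring.
    have -> : ph / 2 + th / 2 - D = th by rewrite /D; field.
    have -> : ph / 2 + th / 2 + D = ph by rewrite /D; field.
    by rewrite thE; lra.
  have sph0 : 0 <= sin (ph / 2) by lra.
  have hS2 : (sin (ph / 2) * cos (ph / 2)) ^+ 2 <= sin (ph / 2 + th / 2) ^+ 2.
    rewrite ler_sqr ?nnegrE //; first by rewrite mulr_ge0.
    by apply: le_trans hS; rewrite mulr_ge0.
  set S := sin (ph / 2 + th / 2) in hS2 eE *.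
  set sp := sin (ph / 2) in hS2 sin2_ge *; set cp := cos (ph / 2) in hS2 *.
  set sD := sin D in hs eE *.
  apply: le_trans (_ : 4 * pi ^+ 2 * s ^+ 2 <= _); last first.
    by rewrite /term_const lerDl; do ?[exact: sqr_ge0|exact: normr_ge0|apply: mulr_ge0]; lra.
  have hA : 2 * cp ^+ 2 * (2 * sin (M%:R * D) ^+ 2) <= 4 * M%:R ^+ 2 * (cp ^+ 2 * sD ^+ 2).
    have : cp ^+ 2 * sin (M%:R * D) ^+ 2 <= cp ^+ 2 * (M%:R ^+ 2 * sD ^+ 2).
      by rewrite ler_wpM2l ?sqr_ge0.
    by rewrite mulrCA; lra.
  have hB : 4 * (sp ^+ 2 * (cp ^+ 2 * sD ^+ 2)) <= e ^+ 2.
    have -> : e ^+ 2 = 4 * (S ^+ 2 * sD ^+ 2) by rewrite eE; ring.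
    have -> : sp ^+ 2 * (cp ^+ 2 * sD ^+ 2) = (sp * cp) ^+ 2 * sD ^+ 2 by ring.
    by rewrite ler_pM2l // ler_wpM2r ?sqr_ge0.
  have hC : ph ^+ 2 / 16 * (cp ^+ 2 * sD ^+ 2) <= sp ^+ 2 * (cp ^+ 2 * sD ^+ 2).
    by rewrite ler_wpM2r //; do ?[exact: sqr_ge0|exact: normr_ge0|apply: mulr_ge0].
  have hD : M%:R ^+ 2 * M%:R ^+ 2 * (ph ^+ 2 / 16 * (cp ^+ 2 * sD ^+ 2) * 4) <=
            M%:R ^+ 2 * M%:R ^+ 2 * e ^+ 2.
    by apply: ler_wpM2l; [do ?[exact: sqr_ge0|apply: mulr_ge0]|lra].
  have hE : M%:R ^+ 2 * M%:R ^+ 2 * e ^+ 2 = pi ^+ 2 * (pi ^+ 2 * s ^+ 2 / 4).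
    have -> : M%:R ^+ 2 * M%:R ^+ 2 * e ^+ 2 = (M%:R ^+ 2 * e) ^+ 2 by ring.
    by rewrite Me; field.
  have hF : M%:R ^+ 2 * M%:R ^+ 2 * (ph ^+ 2 / 16 * (cp ^+ 2 * sD ^+ 2) * 4) =
      pi ^+ 2 * (4 * M%:R ^+ 2 * (cp ^+ 2 * sD ^+ 2) * k%:R ^+ 2 / 16).
    have -> : M%:R ^+ 2 * M%:R ^+ 2 * (ph ^+ 2 / 16 * (cp ^+ 2 * sD ^+ 2) * 4) =
      M%:R ^+ 2 * ph ^+ 2 * (M%:R ^+ 2 / 16 * (cp ^+ 2 * sD ^+ 2) * 4) by field.
    by rewrite ph2E; field.
  rewrite hE hF ler_pM2l // in hD.
  have : 2 * cp ^+ 2 * (2 * sin (M%:R * D) ^+ 2) * k%:R ^+ 2 <=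
         4 * M%:R ^+ 2 * (cp ^+ 2 * sD ^+ 2) * k%:R ^+ 2 by rewrite ler_wpM2r // ltW.
  by lra.
(* Below -1 the weight saves the bound: 1 + cos ph < - e = O(1 / M^2), hence O(1 / k^2) as k < M,
   while parity and [cheb_le_cosh] bound the Chebyshev factor. *)
have ee : `|e| = - e.
  by rewrite ler0_norm //; have := cos_geN1 ph; lra.
have wE : `|e| = (2 * pi * Num.sqrt `|s|) ^+ 2 / (8 * M%:R ^+ 2).
  rewrite exprMn sqr_sqrtr // /e normf_div (normrM (pi ^+ 2)) (gtr0_norm pi2).
  rewrite (@gtr0_norm _ (2 * _)) ?mulr_gt0 //.
  by field; rewrite gt_eqF.
have cb : `|cheb M (cos ph + e)| <= cosh (2 * pi * Num.sqrt `|s|).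
  rewrite -[cos ph + e]opprK chebN normrMsign.
  rewrite (_ : - (cos ph + e) = 1 + (- (cos ph + e) - 1)); last by ring.
  apply: cheb_le_cosh => //; first by rewrite !mulr_ge0 ?sqrtr_ge0 ?ltW.
  by rewrite -wE ee ger0_norm; have := cos_geN1 ph; lra.
rewrite normrM.
have h1 : `|1 + cos ph| <= `|e|.
  by rewrite ee ger0_norm; have := cos_geN1 ph; lra.
have h2 : `|(-1) ^+ k * cheb M (cos ph + e) - 1| <= cosh (2 * pi * Num.sqrt `|s|) + 1.
  by apply: le_trans (ler_normB _ _) _; rewrite normrMsign normr1 lerD2r.
have h3 := ler_pM (normr_ge0 _) (normr_ge0 _) h1 h2.
apply: le_trans (_ : `|e| * (cosh (2 * pi * Num.sqrt `|s|) + 1) * k%:R ^+ 2 <= _).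
  by rewrite ler_wpM2r // ltW.
have Mk : k%:R ^+ 2 <= M%:R ^+ 2 :> R.
  by rewrite ler_sqr ?nnegrE ?ler0n // ler_nat ltnW.
have h4 : `|e| * k%:R ^+ 2 <= pi ^+ 2 * `|s|.
  apply: le_trans (_ : `|e| * M%:R ^+ 2 <= _); first by rewrite ler_wpM2l.
  have -> : `|e| * M%:R ^+ 2 = `|M%:R ^+ 2 * e|.
    by rewrite (normrM (M%:R ^+ 2)) (gtr0_norm M2) mulrC.
  rewrite Me normf_div (normrM (pi ^+ 2)) (gtr0_norm pi2) normr_nat.
  have : 0 <= pi ^+ 2 * `|s| by rewrite mulr_ge0 // ltW.
  by lra.
rewrite mulrAC; apply: le_trans (_ : pi ^+ 2 * `|s| * (cosh (2 * pi * Num.sqrt `|s|) + 1) <= _).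
  by rewrite ler_wpM2r //; lra.
by rewrite /term_const lerDr; do ?[exact: sqr_ge0|exact: normr_ge0|apply: mulr_ge0].
Qed.

Lemma sum_inv_sqr_le K M : (0 < K)%N ->
  \sum_(K.+1 <= k < M) (k%:R ^+ 2)^-1 <= K%:R^-1 :> R.
Proof.
move=> K0; have [MK|KM] := leqP M K; first by rewrite big_geq ?invr_ge0 // leqW.
suff : \sum_(K.+1 <= k < M) (k%:R ^+ 2)^-1 <= K%:R^-1 - (M.-1)%:R^-1 :> R.
  by move/le_trans; apply; rewrite gerBl invr_ge0.
elim: M KM => // M IHM; rewrite ltnS leq_eqVlt => /predU1P[<-|KM].
  by rewrite big_geq //= subrr.
rewrite big_nat_recr //=.
have {}IHM := IHM KM.
have M0 : 0 < M.-1%:R :> R by rewrite ltr0n; lia.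
have ME : M%:R = M.-1%:R + 1 :> R by rewrite natr1; congr (_%:R); lia.
suff : (M%:R ^+ 2)^-1 <= M.-1%:R^-1 - M%:R^-1 :> R by lra.
rewrite ME; set m := M.-1%:R; have m1 : 0 < m + 1 by rewrite addr_gt0.
have -> : m^-1 - (m + 1)^-1 = (m * (m + 1))^-1 by field; rewrite !gt_eqF.
rewrite lef_pV2 ?posrE ?mulr_gt0 ?exprn_gt0 // expr2 ler_pM2r //.
by rewrite lerDl.
Qed.

Definition theta_term s k : R := (-1) ^+ k * chsqrt (pi ^+ 2 * (s - k%:R ^+ 2)) - 1.

Definition theta_psum s K : R :=
  chsqrt (pi ^+ 2 * s) - 1 + 2 * \sum_(1 <= k < K.+1) theta_term s k.

Lemma cvg_cosB1 t :
  (n%:R ^+ 2 * 2 * (cos (t / n%:R) - 1) @[n --> \oo] --> - t ^+ 2)%classic.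
Proof.
apply: cvg_near_eq (@cvg_chsqrt1 R (- t ^+ 2)).
apply: filterS (nbhs_infty_gt 0) => n n0; congr (_ * (_ - 1)).
rewrite /chsqrt; case: ifP => [t0|_].
  have t2 : 0 <= t ^+ 2 by exact: sqr_ge0.
  have -> : t = 0.
    apply/eqP; rewrite -sqrf_eq0 eq_le t2 andbT.
    by move: t0; rewrite pmulr_lge0 ?oppr_ge0 // invr_gt0 exprn_gt0 ?ltr0n.
  rewrite expr0n mul0r oppr0 mul0r sqrtr0 cos0 /cosh oppr0 expR0.
  by field.
by rewrite mulNr opprK -expr_div_n sqrtr_sqr cos_norm.
Qed.

Lemma cvg_cheb_term s k :
  (cheb_term n (pi ^+ 2 * s / (2 * n%:R ^+ 2)) k @[n --> \oo] -->
     2 * theta_term s k)%classic.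
Proof.
rewrite /cheb_term /theta_term.
have cosc : (cos (node R n k) @[n --> \oo] --> (1 : R))%classic.
  have h : (k%:R * pi * n%:R^-1 @[n --> \oo] --> (0 : R))%classic.
    rewrite -[X in (_ --> X)%classic](mulr0 (k%:R * pi)); apply: cvgMl_tmp.
    rewrite -(cvg_shiftS (fun n => n%:R^-1 : R)); exact: cvg_harmonic.
  rewrite -cos0.
  exact: (cvg_comp _ _ h (@continuous_cos R 0)).
rewrite (_ : (2 : R) = 1 + 1); last by ring.
apply: cvgM; first by apply: cvgD => //; exact: cvg_cst.
apply: cvgB; last exact: cvg_cst.
apply: cvgMl_tmp; apply: cvg_cheb.
rewrite [X in (_ --> X)%classic](_ : _ = - (k%:R * pi) ^+ 2 + pi ^+ 2 * s); last by ring.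
apply: cvg_near_eq (cvgD (@cvg_cosB1 (k%:R * pi)) (cvg_cst _)).
apply: filterS (nbhs_infty_gt 0) => n n0 /=; rewrite -/(node R n k).
by field; rewrite pnatr_eq0 -lt0n.
Qed.

(** For fixed K the head of the Chebyshev sum converges termwise, and its tail is at most
    [term_const s] times the sum of 1 / k^2 over k > K, uniformly in n. *)
Lemma theta_psum_dist s K : (0 < K)%N -> 4 * `|s| <= K%:R ^+ 2 ->
  `|theta_psum s K - pi ^+ 2 * s / 2| <= term_const s / K%:R.
Proof.
move=> K0 sK; pose e n : R := pi ^+ 2 * s / (2 * n%:R ^+ 2).
have A : (cheb n (1 + e n) - 1 + \sum_(1 <= k < K.+1) cheb_term n (e n) k
   @[n --> \oo] --> theta_psum s K)%classic.
  rewrite /theta_psum mulr_sumr; apply: cvgD.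
    apply: cvgB; last exact: cvg_cst.
    apply: cvg_cheb; apply: cvg_near_eq (cvg_cst _).
    apply: filterS (nbhs_infty_gt 0) => n n0.
    by rewrite /e; field; rewrite pnatr_eq0 -lt0n.
  by apply: cvg_big => [|k _]; [exact: add_continuous|exact: cvg_cheb_term].
have {}A := cvg_norm (cvgB A (cvg_cst (pi ^+ 2 * s / 2))).
apply: (cvgr_to_le (A _ _ _)); near=> n.
have Kn : (K.+1 < n)%N by near: n; exact: nbhs_infty_gt.
have n0 : n%:R != 0 :> R by rewrite pnatr_eq0; lia.
have n1 : (1 < n)%N by lia.
have := sum_cheb_term (e n) n1.
have -> : n%:R ^+ 2 * e n = pi ^+ 2 * s / 2 by rewrite /e; field.
rewrite (@big_cat_nat _ _ _ K.+1) //=; last by lia.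
set S1 := \sum_(1 <= _ < _) _; set S2 := \sum_(K.+1 <= _ < _) _ => H.
rewrite [X in `|X|](_ : _ = - S2); last by rewrite !fctE -/S1 -H; ring.
rewrite normrN; apply: le_trans (ler_norm_sum _ _ _) _.
apply: le_trans (_ : \sum_(K.+1 <= k < n) term_const s * (k%:R ^+ 2)^-1 <= _).
  rewrite big_nat [leRHS]big_nat; apply: ler_sum => k /andP[Kk kn].
  apply: cheb_term_le; first by lia.
  by apply: le_trans sK _; rewrite ler_sqr ?nnegrE ?ler0n // ler_nat; lia.
rewrite -mulr_sumr ler_wpM2l ?sum_inv_sqr_le //.
have := cosh_ge1 (2 * pi * Num.sqrt `|s|).
by move=> ?; apply: addr_ge0; do ?[exact: sqr_ge0|exact: normr_ge0|apply: mulr_ge0] => //; lra.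
Unshelve. all: by end_near. Qed.

Lemma cvg_theta_psum s :
  (theta_psum s K @[K --> \oo] --> pi ^+ 2 * s / 2)%classic.
Proof.
apply: (@cvg_dist_le _ _ (fun K => term_const s * K%:R^-1)).
  near=> K; apply: theta_psum_dist; first by near: K; exact: nbhs_infty_gt.
  have K1 : 1 <= K%:R :> R by rewrite ler1n; near: K; exact: nbhs_infty_ge.
  apply: le_trans (_ : K%:R <= _); last by rewrite expr2 ler_peMl.
  by near: K; exact: nbhs_infty_ger.
rewrite -[X in (_ --> X)%classic](mulr0 (term_const s)); apply: cvgMl_tmp.
by rewrite -(cvg_shiftS (fun n => n%:R^-1 : R)); exact: cvg_harmonic.
Unshelve. all: by end_near. Qed.

End ThetaChsqrt.
(** * Asymptotics of the number of overpartitions *)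

Section ThetaConv.
Variable R : realType.
Implicit Types (x y t : R) (n k N K L : nat).

Definition theta_conv (f : nat -> R) N : R :=
  f N + 2 * \sum_(1 <= k < N.+1 | (k ^ 2 <= N)%N) (-1) ^+ k * f (N - k ^ 2)%N.

Lemma sum_sqr_le_widen (g : nat -> R) N K : (N <= K)%N ->
  \sum_(1 <= k < N.+1 | (k ^ 2 <= N)%N) g k =
  \sum_(1 <= k < K.+1 | (k ^ 2 <= N)%N) g k.
Proof.
move=> NK; rewrite [RHS](@big_cat_nat _ _ _ N.+1) //=.
rewrite [X in _ + X]big_nat_cond [X in _ + X]big_pred0 ?addr0 // => k.
by apply/negP => /andP[/andP[? _] ?]; nia.
Qed.

Lemma theta_conv_pbar N : theta_conv (fun n => (pbar n)%:R) N = (N == 0%N)%:R.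
Proof.
have := congr1 (fun x : int => x%:~R : R) (pbar_gauss N).
have -> : (N == 0%N)%:R = ((N == 0%N)%:R : int)%:~R :> R by case: eqP.
rewrite /theta_sum rmorphD rmorphM rmorph_sum /= => <-.
rewrite /theta_conv; congr (_ + _ * _).
rewrite big_add1 /= big_mkord [LHS]big_mkcond; apply: eq_bigr => i _.
rewrite rmorphM rmorphXn rmorphN1 /=; case: ifP => [le_iN|/negbT].
  by rewrite subzn.
by rewrite -ltnNge => lt_Ni; rewrite zext_lt0 ?mulr0 //; lia.
Qed.

(** Associativity of convolution, taken from polynomials: truncation beyond degree n does not affect
    the coefficients up to n. *)
Lemma theta_conv_mul (f p : nat -> R) n :
  (forall N, theta_conv p N = (N == 0%N)%:R) ->
  \sum_(j < n.+1) theta_conv f j * p (n - j)%N = f n.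
Proof.
move=> hp; pose T : {poly R} := 1 + 2%:P * \sum_(1 <= k < n.+1) ((-1) ^+ k)%:P * 'X^(k ^ 2).
pose Q (g : nat -> R) : {poly R} := \poly_(i < n.+1) g i.
have TE g N : (N <= n)%N -> (T * Q g)`_N = theta_conv g N.
  move=> Nn; rewrite /T mulrDl mul1r coefD coef_poly ltnS Nn; congr (_ + _).
  rewrite -mulrA coefCM mulr_suml coef_sum; congr (_ * _).
  rewrite (sum_sqr_le_widen _ Nn) [RHS]big_mkcond; apply: eq_bigr => k _.
  rewrite -mulrA coefCM coefXnM ltnNge; case: leqP => /= [kN|]; last by rewrite mulr0.
  by rewrite coef_poly ltnS (leq_trans (leq_subr _ _) Nn).
transitivity ((T * Q f * Q p)`_n).
  rewrite coefM; apply: eq_bigr => j _; rewrite TE -1?ltnS //.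
  by rewrite coef_poly ltnS leq_subr.
rewrite (mulrC T) -mulrA coefM big_ord_recr /= big1 => [|j _].
  by rewrite add0r subnn TE // hp mulr1 coef_poly ltnSn.
by rewrite TE ?leq_subr // hp subn_eq0 leqNgt ltn_ord mulr0.
Qed.

Definition cosh_sqrt n : R := cosh (pi * Num.sqrt n%:R).

Lemma chsqrt_ge0 x : 0 <= x -> chsqrt (pi ^+ 2 * x) = cosh (pi * Num.sqrt x).
Proof.
move=> x0; rewrite /chsqrt mulr_ge0 ?sqr_ge0 //.
by rewrite sqrtrM ?sqr_ge0 // sqrtr_sqr ger0_norm // pi_ge0.
Qed.

Lemma chsqrt_le0 x : 0 <= x -> chsqrt (- (pi ^+ 2 * x)) = cos (pi * Num.sqrt x).
Proof.
move=> x0; rewrite /chsqrt oppr_ge0; case: ifP => h.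
  have -> : x = 0.
    apply/eqP; rewrite eq_le x0 andbT.
    by move: h; rewrite pmulr_rle0 // exprn_gt0 // pi_gt0.
  by rewrite mulr0 oppr0 sqrtr0 mulr0 cos0 /cosh oppr0 expR0; field.
by rewrite opprK sqrtrM ?sqr_ge0 // sqrtr_sqr ger0_norm // pi_ge0.
Qed.

Lemma theta_term_nat N k : (k ^ 2 <= N)%N ->
  theta_term (N%:R : R) k = (-1) ^+ k * cosh_sqrt (N - k ^ 2) - 1.
Proof.
by move=> kN; rewrite /theta_term -natrX -natrB // chsqrt_ge0.
Qed.

Lemma theta_term_cos N k : (N <= k ^ 2)%N ->
  theta_term (N%:R : R) k =
  (-1) ^+ k * cos (pi * Num.sqrt (k ^ 2 - N)%N%:R) - 1.
Proof.
move=> kN; rewrite /theta_term.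
have -> : N%:R - k%:R ^+ 2 = - (k ^ 2 - N)%N%:R :> R by rewrite natrB // natrX opprB.
by rewrite mulrN chsqrt_le0.
Qed.

Lemma theta_termN N k :
  theta_term (- N%:R : R) k =
  (-1) ^+ k * cos (pi * Num.sqrt (k ^ 2 + N)%N%:R) - 1.
Proof.
rewrite /theta_term.
have -> : - N%:R - k%:R ^+ 2 = - (k ^ 2 + N)%N%:R :> R by rewrite natrD natrX opprD addrC.
by rewrite mulrN chsqrt_le0.
Qed.

Lemma signM_le1 k x : `|x| <= 1 -> (-1) ^+ k * x <= 1.
Proof. by move=> h; apply: le_trans (ler_norm _) _; rewrite normrMsign. Qed.

(** In the identity at s = N, terms with k^2 > N are at most 0 and the others only lose their - 1.
    The resulting bound has no error term, so it yields the a priori estimate [psum2_le] for every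
    n. *)
Lemma theta_conv_cosh_ge N : pi ^+ 2 * N%:R / 2 + 1 <= theta_conv cosh_sqrt N.
Proof.
rewrite -lerBrDr; apply: (cvgr_to_le (@cvg_theta_psum R N%:R)).
near=> K.
have NK : (N <= K)%N by near: K; exact: nbhs_infty_ge.
rewrite /theta_psum /theta_conv chsqrt_ge0 // -/(cosh_sqrt N).
rewrite addrAC lerD2r lerD2l ler_pM2l // (sum_sqr_le_widen _ NK).
rewrite [leRHS]big_mkcond; apply: ler_sum => k _.
case: leqP => [kN|Nk]; first by rewrite theta_term_nat // gerBl.
rewrite theta_term_cos; last exact: ltnW.
by rewrite subr_le0 signM_le1 // cos_max.
Unshelve. all: by end_near. Qed.

Lemma sin_le_norm t : `|sin t| <= `|t|.
Proof.
have dsin : is_derive (0 : R) 1 (@sin R) 1 by have := is_derive_sin (0 : R); rewrite cos0.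
have h := cvg_norm (cvg_slope (w := t) (@sin0 R) dsin).
rewrite -[t in leRHS]mulr1; apply: (cvgr_to_ge (h _)).
apply: filterS (nbhs_infty_gt 0) => n n0.
have -> : t = n%:R * (t / n%:R) by field; rewrite pnatr_eq0 -lt0n.
rewrite normrM normr_nat; apply: le_trans (sin_nat_le _ _) _.
by rewrite le_eqVlt; apply/orP; left; apply/eqP; congr (_ * `|sin _|); field; rewrite pnatr_eq0 -lt0n.
Qed.

Lemma cosB_le x y : `|cos x - cos y| <= `|x - y|.
Proof.
have -> : cos x - cos y = - (2 * (sin ((x + y) / 2) * sin ((x - y) / 2))).
  rewrite {1}(_ : x = (x + y) / 2 + (x - y) / 2); last by field.
  rewrite {3}(_ : y = (x + y) / 2 - (x - y) / 2); last by field.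
  by set P := (x + y) / 2; set D := (x - y) / 2; rewrite cosD cosB; ring.
rewrite normrN !normrM normr_nat.
have h1 : `|sin ((x + y) / 2)| * `|sin ((x - y) / 2)| <= 1 * `|(x - y) / 2|.
  by apply: ler_pM => //; [exact: sin_max|exact: sin_le_norm].
rewrite mul1r normf_div normr_nat in h1.
by lra.
Qed.

(** With a and b the two square roots, k - a and b - k are both about N / (2 k), and cosine is even
    up to sign about pi k. What remains is 2 k - a - b = (b - a)^2 / (2 k + a + b), of order N^2 /
    k^3. *)
Lemma cos_sqrtB_le N k : (0 < k)%N -> (N <= k ^ 2)%N ->
  `|cos (pi * Num.sqrt ((k ^ 2 - N)%N%:R : R)) - cos (pi * Num.sqrt (k ^ 2 + N)%N%:R)|
    <= 2 * pi * N%:R ^+ 2 / k%:R ^+ 3.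
Proof.
move=> k0 Nk; have K0 : 0 < k%:R :> R by rewrite ltr0n.
set a := Num.sqrt _; set b := Num.sqrt _.
have a0 : 0 <= a by exact: sqrtr_ge0.
have b0 : 0 <= b by exact: sqrtr_ge0.
have aE : a ^+ 2 = k%:R ^+ 2 - N%:R by rewrite sqr_sqrtr // natrB // natrX.
have bE : b ^+ 2 = k%:R ^+ 2 + N%:R by rewrite sqr_sqrtr // natrD natrX.
have kb : k%:R <= b by rewrite -(@ler_sqr R) ?nnegrE // bE lerDl.
have pi0 := pi_gt0 R.
have cosk t : cos (pi * t) = (-1) ^+ k * cos (pi * (t - k%:R)).
  rewrite -cos_natpi; congr cos; ring.
rewrite (cosk a) (cosk b) -mulrBr normrMsign -(cosN (pi * (a - _))) -mulrN opprB.
apply: le_trans (cosB_le _ _) _.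
rewrite -mulrBr normrM gtr0_norm // -[2 * pi]mulrC -!mulrA ler_pM2l //.
have ab0 : 0 < 2 * k%:R + a + b by lra.
have -> : k%:R - a - (b - k%:R) = (b - a) ^+ 2 / (2 * k%:R + a + b).
  apply: (@mulIf _ (2 * k%:R + a + b)); first by rewrite gt_eqF.
  rewrite divfK ?gt_eqF //.
  have -> : (k%:R - a - (b - k%:R)) * (2 * k%:R + a + b) = 4 * k%:R ^+ 2 - (a + b) ^+ 2 by ring.
  have : (b - a) ^+ 2 + (a + b) ^+ 2 = 2 * (a ^+ 2 + b ^+ 2) by ring.
  by rewrite aE bE; lra.
rewrite ger0_norm; last by rewrite divr_ge0 ?sqr_ge0 // ltW.
have ba : a <= b by rewrite -(@ler_sqr R) ?nnegrE // aE bE; have := ler0n R N; lra.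
have h1 : k%:R * (b - a) <= 2 * N%:R.
  have : (a + b) * (b - a) = 2 * N%:R.
    have -> : (a + b) * (b - a) = b ^+ 2 - a ^+ 2 by ring.
    by rewrite aE bE; ring.
  move=> <-; rewrite ler_wpM2r ?subr_ge0 //; lra.
have h2 : (k%:R * (b - a)) ^+ 2 <= (2 * N%:R) ^+ 2.
  by rewrite ler_sqr ?nnegrE ?mulr_ge0 ?subr_ge0 ?ler0n // ltW.
have h3 : k%:R * (k%:R * (b - a)) ^+ 2 <= k%:R * (2 * N%:R) ^+ 2.
  by rewrite ler_pM2l.
rewrite ler_pdivrMr // mulrAC -mulrA.
rewrite [leRHS](_ : _ = 2 * N%:R ^+ 2 * (2 * k%:R + a + b) / k%:R ^+ 3); last by ring.
rewrite ler_pdivlMr ?exprn_gt0 //.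
have h4 : N%:R ^+ 2 * (3 * k%:R) <= N%:R ^+ 2 * (2 * k%:R + a + b).
  by rewrite ler_wpM2l ?sqr_ge0 //; lra.
have e3 : k%:R * (k%:R * (b - a)) ^+ 2 = (b - a) ^+ 2 * k%:R ^+ 3 by ring.
have h5 : 0 <= N%:R ^+ 2 * k%:R :> R by rewrite mulr_ge0 ?sqr_ge0 // ltW.
by rewrite -e3; lra.
Qed.

(* Subtracting the identities at [N] and [- N] cancels the divergent 1s. *)
Lemma theta_conv_cosh_sub_le N L : (0 < L)%N -> (N <= L ^ 2)%N ->
  `|theta_conv cosh_sqrt N - pi ^+ 2 * N%:R| <=
  1 + 4 * L%:R + 4 * pi * N%:R ^+ 2 / L%:R ^+ 2.
Proof.
move=> L0 NL; have l0 : 0 < L%:R :> R by rewrite ltr0n.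
have pi0 := pi_gt0 R.
have H := cvgB (@cvg_theta_psum R N%:R) (@cvg_theta_psum R (- N%:R)).
have {}H := cvg_norm (cvgB (cvg_cst (theta_conv cosh_sqrt N)) (H _)).
have -> : pi ^+ 2 * N%:R = pi ^+ 2 * N%:R / 2 - pi ^+ 2 * (- N%:R) / 2 :> R by field.
apply: (cvgr_to_le (H _ _ _ _)); near=> K.
have NK : (N <= K)%N by near: K; exact: nbhs_infty_ge.
have LK : (L <= K)%N by near: K; exact: nbhs_infty_ge.
rewrite !fctE.
pose d k : R := (if (k ^ 2 <= N)%N then 0 else cos (pi * Num.sqrt (k ^ 2 - N)%N%:R))
                - cos (pi * Num.sqrt (k ^ 2 + N)%N%:R).
rewrite [X in `|X|](_ : _ = chsqrt (pi ^+ 2 * - N%:R)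
     - 2 * \sum_(1 <= k < K.+1) (-1) ^+ k * d k); last first.
  rewrite /theta_conv (sum_sqr_le_widen _ NK) big_mkcond /= /theta_psum.
  rewrite chsqrt_ge0 // -/(cosh_sqrt N).
  set A := \sum_(_ <= _ < _) _; set B := \sum_(_ <= _ < _) _.
  set C := \sum_(_ <= _ < _) _; set D := \sum_(_ <= _ < _) _.
  suff : A - B + C + D = 0 by lra.
  rewrite /A /B /C /D -sumrB -!big_split big1 //= => k _.
  rewrite theta_termN /d; case: leqP => kN.
    by rewrite theta_term_nat //; ring.
  by rewrite theta_term_cos ?(ltnW kN) //; ring.
have d_le2 k : `|d k| <= 2.
  rewrite /d; apply: le_trans (ler_normB _ _) _.
  rewrite (_ : 2 = 1 + 1 :> R); last by ring.
  by apply: lerD; rewrite ?cos_max //; case: ifP; rewrite ?normr0 ?cos_max.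
have d_le k : (L < k)%N -> `|d k| <= 2 * pi * N%:R ^+ 2 / L%:R * (k%:R ^+ 2)^-1.
  move=> Lk; have kN : (N < k ^ 2)%N by apply: leq_ltn_trans NL _; rewrite ltn_sqr.
  rewrite /d leqNgt kN /=.
  have k0 : (0 < k)%N by lia.
  apply: le_trans (cos_sqrtB_le k0 (ltnW kN)) _.
  have : 0 <= N%:R ^+ 2 :> R by exact: sqr_ge0.
  move: (N%:R ^+ 2) => n2 n2_ge0.
  rewrite -!mulrA ler_pM2l // ler_pM2l //; apply: ler_wpM2l => //.
  rewrite -invfM lef_pV2 ?posrE ?mulr_gt0 ?exprn_gt0 ?ltr0n // exprS.
  by rewrite ler_wpM2r ?sqr_ge0 // ler_nat ltnW.
apply: le_trans (ler_normB _ _) _; rewrite -addrA; apply: lerD.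
  by rewrite mulrN chsqrt_le0 // cos_max.
rewrite normrM normr_nat.
suff : `|\sum_(1 <= k < K.+1) (-1) ^+ k * d k| <=
   2 * L%:R + 2 * pi * N%:R ^+ 2 / L%:R / L%:R.
  rewrite [4 * pi * _ / _](_ : _ = 2 * (2 * pi * N%:R ^+ 2 / L%:R / L%:R)); first by lra.
  by field; rewrite gt_eqF.
apply: le_trans (ler_norm_sum _ _ _) _.
under eq_bigr => k _ do rewrite normrMsign.
rewrite (@big_cat_nat _ _ _ L.+1) //=; apply: lerD.
  apply: le_trans (_ : \sum_(1 <= k < L.+1) (2 : R) <= _); first exact: ler_sum.
  by rewrite sumr_const_nat subn1 /= mulr_natr.
apply: le_trans (_ : \sum_(L.+1 <= k < K.+1)
    2 * pi * N%:R ^+ 2 / L%:R * (k%:R ^+ 2)^-1 <= _).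
  by rewrite big_nat [leRHS]big_nat; apply: ler_sum => k /andP[Lk _]; exact: d_le.
rewrite -mulr_sumr ler_wpM2l ?sum_inv_sqr_le //.
by rewrite divr_ge0 ?mulr_ge0 ?sqr_ge0 // ltW.
Unshelve. all: by end_near. Qed.

(** The cut L is about N / m with m >= 4 / eps: the head costs 4 N / m <= eps N, the tail the
    constant 4 pi m^2. For N < m^2, where N <= L^2 may fail, the finite sum [C2] takes over. *)
Lemma theta_conv_cosh_asymp (eps : R) : 0 < eps ->
  exists C : R, forall N,
    `|theta_conv cosh_sqrt N - pi ^+ 2 * N%:R| <= eps * N%:R + C.
Proof.
move=> e0; pose m := (Num.truncn (4 / eps)).+1.
have m_gt0 : 0 < m%:R :> R by rewrite ltr0n.
have m_ge : 4 / m%:R <= eps.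
  rewrite ler_pdivrMr // mulrC -ler_pdivrMr // ltW //.
  by have := truncnS_gt (4 / eps).
pose C1 : R := 5 + 4 * pi * m%:R ^+ 2.
pose C2 : R := \sum_(N < m ^ 2) `|theta_conv cosh_sqrt N - pi ^+ 2 * N%:R|.
have pi0 := pi_gt0 R.
have C1_ge0 : 0 <= C1.
  have : 0 <= 4 * pi * m%:R ^+ 2 :> R by rewrite mulr_ge0 ?sqr_ge0 // mulr_ge0 // ltW.
  by rewrite /C1; lra.
have C2_ge0 : 0 <= C2 by exact: sumr_ge0.
exists (C1 + C2) => N; have en0 : 0 <= eps * N%:R by rewrite mulr_ge0 // ltW.
have [Nm|mN] := ltnP N (m ^ 2).
  apply: le_trans (_ : C2 <= _); last by lra.
  rewrite /C2 (bigD1 (Ordinal Nm)) //= lerDl; exact: sumr_ge0.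
pose L := (N %/ m).+1.
have LN : (N < L * m)%N by rewrite /L ltn_ceil.
have NL : (N <= L ^ 2)%N.
  have : (m <= L)%N by nia.
  by nia.
apply: le_trans (theta_conv_cosh_sub_le (L := L) _ NL) _ => //.
have l0 : 0 < L%:R :> R by rewrite ltr0n.
have h1 : L%:R <= N%:R / m%:R + 1 :> R.
  rewrite /L -natr1 lerD2r ler_pdivlMr // -natrM ler_nat.
  exact: leq_divM.
have h2 : N%:R / L%:R <= m%:R :> R.
  by rewrite ler_pdivrMr // -natrM ler_nat mulnC ltnW.
have h3 : (N%:R / L%:R) ^+ 2 <= m%:R ^+ 2 :> R.
  by rewrite ler_sqr ?nnegrE ?divr_ge0.
have h4 : 4 * pi * N%:R ^+ 2 / L%:R ^+ 2 <= 4 * pi * m%:R ^+ 2 :> R.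
  have -> : 4 * pi * N%:R ^+ 2 / L%:R ^+ 2 = 4 * pi * (N%:R / L%:R) ^+ 2 :> R.
    by field; rewrite gt_eqF.
  by rewrite ler_wpM2l // mulr_ge0 // ltW.
have h5 : 4 / m%:R * N%:R <= eps * N%:R by rewrite ler_wpM2r.
have e5 : 4 / m%:R * N%:R = 4 * (N%:R / m%:R) :> R by ring.
by rewrite /C1; lra.
Qed.

End ThetaConv.

(** * Asymptotics of the double sums, and the effect of shifting the index *)

Section PbarAsymptotics.
Variable R : realType.
Implicit Types (x y c d : R) (n k h m kappa : nat).

Definition exp_sqrt n : R := expR (pi * Num.sqrt n%:R).

Lemma exp_sqrt_gt0 n : 0 < exp_sqrt n.
Proof. exact: expR_gt0. Qed.

Lemma cosh_sqrt_gt0 n : 0 < cosh_sqrt R n.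
Proof. by rewrite /cosh_sqrt; have := cosh_ge1 (pi * Num.sqrt (n%:R : R)); lra. Qed.

Lemma sqrt_natr_cvgy : (Num.sqrt (n%:R : R) @[n --> \oo] --> +oo)%classic.
Proof.
apply/cvgryPge => A; near=> n.
have [A0|A0] := leP A 0; first exact: le_trans (sqrtr_ge0 _).
rewrite -(@ler_sqr R) ?nnegrE ?sqrtr_ge0 ?(ltW A0) // sqr_sqrtr //.
by near: n; exact: nbhs_infty_ger.
Unshelve. all: by end_near. Qed.

Lemma cvg_inv_sqrt_natr : ((Num.sqrt (n%:R : R))^-1 @[n --> \oo] --> (0 : R))%classic.
Proof.
apply/gtr0_cvgV0; last exact: sqrt_natr_cvgy.
by apply: filterS (nbhs_infty_gt 0) => n n0; rewrite sqrtr_gt0 ltr0n.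
Qed.

Section Weighted.
Variable p : nat -> R.
Hypothesis p_theta : forall N, theta_conv p N = (N == 0%N)%:R.
Hypothesis p_ge0 : forall n, 0 <= p n.

Definition psum1 n : R := \sum_(i < n.+1) p i.
Definition psum2 n : R := \sum_(i < n) psum1 i.

Lemma psum1_rev n : \sum_(j < n.+1) p (n - j)%N = psum1 n.
Proof. by rewrite (reindex_inj rev_ord_inj) /=; apply: eq_bigr => j _; rewrite subKn // -ltnS. Qed.

Lemma psum2_conv n : \sum_(j < n.+1) j%:R * p (n - j)%N = psum2 n.
Proof.
elim: n => [|n IHn]; first by rewrite big_ord1 mul0r /psum2 big_ord0.
rewrite big_ord_recl mul0r add0r [RHS]big_ord_recr /= -/(psum2 n) -IHn -psum1_rev.
rewrite -big_split; apply: eq_bigr => j _ /=.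
by rewrite /bump /= add1n subSS -natr1 mulrDl mul1r.
Qed.

Lemma psum1_ge0 n : 0 <= psum1 n.
Proof. exact: sumr_ge0. Qed.

Lemma psum2_ge0 n : 0 <= psum2 n.
Proof. by apply: sumr_ge0 => i _; exact: psum1_ge0. Qed.

Lemma psum2_le n : psum2 n <= cosh_sqrt R n.
Proof.
rewrite -(theta_conv_mul (cosh_sqrt R) n p_theta) -psum2_conv.
apply: ler_sum => j _; apply: ler_wpM2r => //.
apply: le_trans (theta_conv_cosh_ge R j).
have : 2 * 2 <= pi * pi :> R by apply: ler_pM => //; exact: pi_ge2.
rewrite -expr2 => pi2.
have : 4 * (j%:R : R) <= pi ^+ 2 * j%:R by rewrite ler_wpM2r //; lra.
by have := ler0n R j; lra.
Qed.

Lemma psum1_leS n : psum1 n <= psum1 n.+1.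
Proof. by rewrite /psum1 [leRHS]big_ord_recr lerDl. Qed.

(** With [psum2_le] and [cosh_sqrt_shift], this gives [psum1] <= (2 e^pi / h) [cosh_sqrt] once h^2
    <= n. As h is arbitrary, the bounded part of the error in F contributes negligibly. *)
Lemma mul_psum1_le n h : h%:R * psum1 n <= psum2 (n + h).
Proof.
elim: h => [|h IHh]; first by rewrite mul0r psum2_ge0.
rewrite -natr1 mulrDl mul1r addnS /psum2 big_ord_recr; apply: lerD => //=.
elim: h {IHh} => [|h]; first by rewrite addn0.
by move/le_trans; apply; rewrite addnS psum1_leS.
Qed.

Lemma cosh_sqrt_shift n h : (h ^ 2 <= n)%N ->
  cosh_sqrt R (n + h) <= 2 * expR pi * cosh_sqrt R n.
Proof.
move=> hn; have pi0 := pi_gt0 R.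
have hs : h%:R <= Num.sqrt (n%:R : R).
  by rewrite -(@ler_sqr R) ?nnegrE ?sqrtr_ge0 // sqr_sqrtr // -natrX ler_nat.
have le1 : Num.sqrt (n + h)%N%:R <= Num.sqrt (n%:R : R) + 1.
  rewrite -(@ler_sqr R) ?nnegrE ?sqrtr_ge0 ?addr_ge0 ?sqrtr_ge0 //.
  rewrite sqrrD1 !sqr_sqrtr // natrD mulr2n.
  by have := sqrtr_ge0 (n%:R : R); lra.
have u : cosh_sqrt R (n + h) <= exp_sqrt (n + h).
  rewrite /cosh_sqrt /cosh /exp_sqrt.
  have : expR (- (pi * Num.sqrt ((n + h)%N%:R : R))) <= expR (pi * Num.sqrt (n + h)%N%:R).
    rewrite ler_expR; have : 0 <= pi * Num.sqrt ((n + h)%N%:R : R).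
      by rewrite mulr_ge0 ?sqrtr_ge0 // ltW.
    by lra.
  by lra.
have l : exp_sqrt n <= 2 * cosh_sqrt R n.
  rewrite /cosh_sqrt /cosh /exp_sqrt.
  by have := expR_gt0 (- (pi * Num.sqrt (n%:R : R))); lra.
apply: le_trans u _.
have : exp_sqrt (n + h) <= expR pi * exp_sqrt n.
  rewrite /exp_sqrt -expRD ler_expR -[X in X + _]mulr1 -mulrDr ler_pM2l //.
  by rewrite addrC.
have : expR pi * exp_sqrt n <= expR pi * (2 * cosh_sqrt R n).
  by rewrite ler_pM2l ?expR_gt0.
by lra.
Qed.

Lemma psum2_asymp (eps : R) : 0 < eps ->
  (\forall n \near \oo,
     `|cosh_sqrt R n - pi ^+ 2 * psum2 n| <= eps * cosh_sqrt R n)%classic.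
Proof.
move=> e0; have e2 : 0 < eps / 2 by rewrite divr_gt0.
have [C0 hC0] := theta_conv_cosh_asymp e2.
pose C := Num.max C0 0; have C_ge0 : 0 <= C by rewrite le_max lexx orbT.
have hC N : `|theta_conv (cosh_sqrt R) N - pi ^+ 2 * N%:R| <= eps / 2 * N%:R + C.
  by apply: le_trans (hC0 N) _; rewrite lerD2l le_max lexx.
have ep := expR_gt0 (pi : R).
(* Large enough that C (2 e^pi / h) <= eps / 2. *)
pose h := (Num.truncn (4 * C * expR pi / eps)).+1.
have h_gt0 : 0 < h%:R :> R by rewrite ltr0n.
have hle : 2 * C * expR pi / h%:R <= eps / 2.
  have : 4 * C * expR pi / eps < h%:R by exact: truncnS_gt.
  rewrite ltr_pdivrMr // ler_pdivrMr //; lra.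
apply: filterS (nbhs_infty_ge (h ^ 2)) => n hn.
have b0 := cosh_sqrt_gt0 n.
have -> : cosh_sqrt R n - pi ^+ 2 * psum2 n =
    \sum_(j < n.+1) (theta_conv (cosh_sqrt R) j - pi ^+ 2 * j%:R) * p (n - j)%N.
  rewrite -{1}(theta_conv_mul (cosh_sqrt R) n p_theta) -psum2_conv mulr_sumr -sumrB.
  by apply: eq_bigr => j _; ring.
apply: le_trans (ler_norm_sum _ _ _) _.
apply: le_trans (_ : eps / 2 * psum2 n + C * psum1 n <= _).
  rewrite -psum2_conv -psum1_rev !mulr_sumr -big_split /=; apply: ler_sum => j _.
  by rewrite normrM (ger0_norm (p_ge0 _)) mulrA -mulrDl ler_wpM2r.
have h1 : eps / 2 * psum2 n <= eps / 2 * cosh_sqrt R n.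
  by rewrite ler_pM2l // psum2_le.
have h2 : h%:R * (C * psum1 n) <= h%:R * (2 * C * expR pi / h%:R * cosh_sqrt R n).
  rewrite mulrCA.
  apply: le_trans (_ : C * (2 * expR pi * cosh_sqrt R n) <= _).
    rewrite ler_wpM2l //; apply: le_trans (mul_psum1_le n h) _.
    by apply: le_trans (psum2_le _) _; exact: cosh_sqrt_shift.
  by rewrite le_eqVlt; apply/orP; left; apply/eqP; field; rewrite gt_eqF.
rewrite ler_pM2l // in h2.
have h3 : 2 * C * expR pi / h%:R * cosh_sqrt R n <= eps / 2 * cosh_sqrt R n.
  by rewrite ler_pM2r.
by lra.
Qed.

Lemma cvg_psum2 :
  (psum2 n / exp_sqrt n @[n --> \oo] --> (2 * pi ^+ 2)^-1)%classic.
Proof.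
have pi0 := pi_gt0 R.
have h1 : (pi ^+ 2 * psum2 n / cosh_sqrt R n @[n --> \oo] --> (1 : R))%classic.
  apply/cvgrPdist_le => eps e0; apply: filterS (psum2_asymp e0) => n hn.
  have b0 := cosh_sqrt_gt0 n.
  rewrite -(ler_pM2r b0) -[X in _ * X <= _](gtr0_norm b0) -normrM mulrBl mul1r.
  by rewrite divfK // gt_eqF.
have h2 : (cosh_sqrt R n / exp_sqrt n @[n --> \oo] --> (2^-1 : R))%classic.
  apply: (@cvg_dist_le _ _ (fun n => (Num.sqrt (n%:R : R))^-1)); last first.
    exact: cvg_inv_sqrt_natr.
  apply: filterS (nbhs_infty_gt 0) => n n0.
  have s0 : 0 < Num.sqrt (n%:R : R) by rewrite sqrtr_gt0 ltr0n.
  rewrite /cosh_sqrt /cosh /exp_sqrt; set t := pi * _.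
  have -> : (expR t + expR (- t)) / 2 / expR t - 2^-1 = expR (- t) / expR t / 2.
    by field; rewrite gt_eqF // expR_gt0.
  rewrite -expRN -expRD ger0_norm; last by rewrite divr_ge0 // expR_ge0.
  have t_ge : 2 * Num.sqrt n%:R <= t by rewrite /t ler_pM2r // pi_ge2.
  rewrite -opprD expRN ler_pdivrMr // mulrC -ler_pdivrMl //.
  rewrite -invfM lef_pV2 ?posrE ?mulr_gt0 ?expR_gt0 //.
  by have := expR_ge1Dx (t + t); lra.
rewrite (_ : (2 * pi ^+ 2)^-1 = 1 * 2^-1 * (pi ^+ 2)^-1); last by rewrite mul1r invfM.
have E (q x b e : R) : q != 0 -> b != 0 -> e != 0 ->
    x / e = q ^+ 2 * x / b * (b / e) / q ^+ 2.
  by move=> *; field; apply/and3P.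
apply: cvg_near_eq (cvgMr_tmp (cvgM h1 h2)); apply: nearW => n /=.
by apply: E; rewrite gt_eqF // ?cosh_sqrt_gt0 ?exp_sqrt_gt0.
Qed.

End Weighted.

(** sqrt(u n) - sqrt n = (u n - n) / (sqrt(u n) + sqrt n) tends to d / 2, while sqrt(u n) / sqrt n
    tends to 1, so only the exponential feels the shift. *)
Lemma cvg_shift (A : nat -> R) (u : nat -> nat) kappa c d :
  (((u n)%:R - n%:R) / Num.sqrt (n%:R : R) @[n --> \oo] --> d)%classic ->
  (A n * Num.sqrt n%:R ^+ kappa / exp_sqrt n @[n --> \oo] --> c)%classic ->
  (A (u n) * Num.sqrt n%:R ^+ kappa / exp_sqrt n @[n --> \oo] -->
     c * expR (pi * (d / 2)))%classic.
Proof.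
move=> hu hA.
have un : ((u n)%:R / n%:R @[n --> \oo] --> (1 : R))%classic.
  have := cvgD (cvg_cst (1 : R)) (cvgM hu cvg_inv_sqrt_natr).
  move=> /(_ _ _); rewrite mulr0 addr0 => h; apply: cvg_near_eq (h _).
  apply: filterS (nbhs_infty_gt 0) => n n0 /=.
  have s0 : 0 < Num.sqrt (n%:R : R) by rewrite sqrtr_gt0 ltr0n.
  have -> : n%:R = Num.sqrt (n%:R : R) ^+ 2 by rewrite sqr_sqrtr.
  rewrite sqrtr_sqr ger0_norm ?sqrtr_ge0 //.
  by field; rewrite gt_eqF.
have uy : (u n @[n --> \oo] --> \oo)%classic.
  apply/cvgnyPge => m; near=> n.
  have n_gt0 : 0 < n%:R :> R by rewrite ltr0n; near: n; exact: nbhs_infty_gt.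
  have h1 : 1 / 2 <= (u n)%:R / n%:R :> R.
    by near: n; apply: (cvgr_ge _ un); lra.
  rewrite ler_pdivlMr // in h1.
  have h2 : (2 * m <= n)%N by near: n; exact: nbhs_infty_ge.
  rewrite -(ler_nat R); move: h2; rewrite -(ler_nat R) natrM; lra.
have sq : (Num.sqrt (u n)%:R / Num.sqrt n%:R @[n --> \oo] --> (1 : R))%classic.
  rewrite -[X in (_ --> X)%classic]sqrtr1.
  apply: cvg_near_eq (cvg_comp _ _ un (@sqrt_continuous R 1)).
  by apply: nearW => n /=; rewrite sqrtrM // sqrtrV.
have sd : (Num.sqrt (u n)%:R - Num.sqrt n%:R @[n --> \oo] --> (d / 2 : R))%classic.
  have h1 : (Num.sqrt (u n)%:R / Num.sqrt n%:R + 1 @[n --> \oo] --> (1 + 1 : R))%classic.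
    by apply: cvgD => //; exact: cvg_cst.
  have n2 : 1 + 1 != 0 :> R by rewrite (_ : 1 + 1 = 2) ?pnatr_eq0.
  rewrite (_ : d / 2 = d * (1 + 1)^-1); last by congr (_ / _); ring.
  apply: cvg_near_eq (cvgM hu (cvgV n2 h1)).
  apply: filterS (nbhs_infty_gt 0) => n n0 /=.
  have s0 : 0 < Num.sqrt (n%:R : R) by rewrite sqrtr_gt0 ltr0n.
  have s1 := sqrtr_ge0 ((u n)%:R : R).
  have := sqr_sqrtr (ler0n R n); have := sqr_sqrtr (ler0n R (u n)).
  set a := Num.sqrt _ in s1 *; set b := Num.sqrt _ in s0 * => <- <-.
  by field; rewrite !gt_eqF //; lra.
have ge : (expR (pi * (Num.sqrt (u n)%:R - Num.sqrt n%:R)) @[n --> \oo] -->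
    expR (pi * (d / 2)))%classic.
  exact: (cvg_comp _ _ (cvgMl_tmp sd) (@continuous_expR R _)).
have sk : ((Num.sqrt (u n)%:R / Num.sqrt n%:R) ^- kappa @[n --> \oo] --> (1 : R))%classic.
  have h : ((Num.sqrt (u n)%:R / Num.sqrt n%:R) ^+ kappa @[n --> \oo] --> (1 ^+ kappa : R))%classic.
    exact: (cvg_comp _ _ sq (@exprn_continuous R kappa 1)).
  have n1 : 1 ^+ kappa != 0 :> R by rewrite expr1n oner_eq0.
  have {}h := cvgV n1 h.
  by rewrite expr1n invr1 in h; exact: h.
have hAu := cvg_comp _ _ uy hA.
rewrite -[X in (_ --> X)%classic]mulr1.
apply: cvg_near_eq (cvgM (cvgM hAu ge) sk).
near=> n => /=.
have s0 : 0 < Num.sqrt (n%:R : R).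
  by rewrite sqrtr_gt0 ltr0n; near: n; exact: nbhs_infty_gt.
have s1 : 0 < Num.sqrt ((u n)%:R : R).
  rewrite sqrtr_gt0 ltr0n; near: n; exact: (cvgnyPgt _).1.
rewrite mulrBr expRD expRN -/(exp_sqrt _) -/(exp_sqrt _) expr_div_n.
by field; rewrite !gt_eqF ?exp_sqrt_gt0 ?exprn_gt0.
Unshelve. all: by end_near. Qed.

End PbarAsymptotics.

(** * Differencing asymptotics under monotonicity *)

Section Increments.
Variable R : realType.
Implicit Types (c : R) (n h m kappa : nat).

Lemma cvg_trunc_sqrt m : (0 < m)%N ->
  ((Num.truncn (Num.sqrt (n%:R : R) / m%:R))%:R / Num.sqrt n%:R @[n --> \oo] -->
     (m%:R^-1 : R))%classic.
Proof.
move=> m0; have m_gt0 : 0 < m%:R :> R by rewrite ltr0n.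
apply: (@cvg_dist_le _ _ (fun n => (Num.sqrt (n%:R : R))^-1)); last first.
  exact: cvg_inv_sqrt_natr.
apply: filterS (nbhs_infty_gt 0) => n n0.
have s0 : 0 < Num.sqrt (n%:R : R) by rewrite sqrtr_gt0 ltr0n.
set s := Num.sqrt _ in s0 *.
have sm : 0 <= s / m%:R by rewrite divr_ge0 // ltW.
have /andP[h1 h2] := truncn_itv sm.
set t := Num.truncn _ in h1 h2 *.
have -> : t%:R / s - m%:R^-1 = (t%:R - s / m%:R) / s.
  by field; rewrite !gt_eqF.
rewrite normrM [X in _ * X]gtr0_norm ?invr_gt0 // -[leRHS]mul1r ler_pM2r ?invr_gt0 //.
by rewrite ler_norml; apply/andP; split; move: h1 h2; rewrite -natr1; lra.
Qed.

Lemma mul_increment_le (A a : nat -> R) n h :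
  (forall n, A n.+1 - A n = a n) -> {homo a : i j / (i <= j)%N >-> i <= j} ->
  h%:R * a n <= A (n + h)%N - A n.
Proof.
move=> Aa a_homo; elim: h => [|h IHh]; first by rewrite addn0 mul0r subrr.
rewrite -natr1 mulrDl mul1r addnS -[A _.+1](subrK (A (n + h)%N)) Aa.
by have : a n <= a (n + h)%N by [apply: a_homo; exact: leq_addr]; lra.
Qed.

Lemma mul_increment_ge (A a : nat -> R) n h : (h <= n)%N ->
  (forall n, A n.+1 - A n = a n) -> {homo a : i j / (i <= j)%N >-> i <= j} ->
  A n - A (n - h)%N <= h%:R * a n.
Proof.
move=> + Aa a_homo; elim: h => [|h IHh] hn; first by rewrite subn0 mul0r subrr.
have {}IHh := IHh (ltnW hn).
rewrite -natr1 mulrDl mul1r.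
have := Aa (n - h.+1)%N; rewrite -subSn // subSS.
have : a (n - h.+1)%N <= a n by apply: a_homo; exact: leq_subr.
by lra.
Qed.

(** Monotonicity squeezes a(n) between the mean increments of A over the windows of length h, about
    sqrt n / m, before and after n. After scaling these tend to c m (1 - e^(- pi / (2 m))) and c m
    (e^(pi / (2 m)) - 1), both close to c pi / 2 for m large. So m is fixed before n grows. *)
Lemma cvg_increments (A a : nat -> R) kappa c :
  (forall n, A n.+1 - A n = a n) -> {homo a : i j / (i <= j)%N >-> i <= j} ->
  (A n * Num.sqrt n%:R ^+ kappa / exp_sqrt R n @[n --> \oo] --> c)%classic ->
  (a n * Num.sqrt n%:R ^+ kappa.+1 / exp_sqrt R n @[n --> \oo] --> c * (pi / 2))%classic.
Proof.
move=> Aa a_homo hA; apply/cvgrPdist_le => eps e0.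
have e2 : 0 < eps / 2 by rewrite divr_gt0.
(* The signs s = 1 and s = -1 treat the forward and the backward window at once. *)
have dexp (s : R) : is_derive (0 : R) 1 (fun t => s * (expR (s * t) - 1)) (s * s).
  by apply: is_derive_eq; rewrite /GRing.scale /= mulr0 expR0; ring.
have g0 (s : R) : s * (expR (s * 0) - 1) = 0 by rewrite mulr0 expR0 subrr mulr0.
have slope (s : R) : s * s = 1 ->
    (c * (n%:R * (s * (expR (s * (pi / 2 / n%:R)) - 1))) @[n --> \oo] --> c * (pi / 2))%classic.
  move=> ss; apply: cvgMl_tmp.
  rewrite [X in (_ --> X)%classic](_ : _ = pi / 2 * (s * s)); last by rewrite ss mulr1.
  exact: (cvg_slope (w := pi / 2) (g0 s) (dexp s)).
have [m m0 [hU hL]] : exists2 m, (0 < m)%N &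
    `|c * (pi / 2) - c * (m%:R * (1 * (expR (1 * (pi / 2 / m%:R)) - 1)))| <= eps / 2 /\
    `|c * (pi / 2) - c * (m%:R * (-1 * (expR (-1 * (pi / 2 / m%:R)) - 1)))| <= eps / 2.
  have hU := (cvgrPdist_le _ _).1 (slope 1 (mulr1 1)) _ e2.
  have NN : -1 * -1 = 1 :> R by rewrite mulrNN mulr1.
  have hL := (cvgrPdist_le _ _).1 (slope (-1) NN) _ e2.
  near \oo%classic => m; exists m; first by near: m; exact: nbhs_infty_gt.
  by split; near: m; [exact: hU|exact: hL].
have m_gt0 : 0 < m%:R :> R by rewrite ltr0n.
pose h n := Num.truncn (Num.sqrt (n%:R : R) / m%:R).
have hh : ((h n)%:R / Num.sqrt n%:R @[n --> \oo] --> (m%:R^-1 : R))%classic.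
  exact: cvg_trunc_sqrt.
have mi : m%:R^-1 != 0 :> R by rewrite gt_eqF // invr_gt0.
have hV : (((h n)%:R / Num.sqrt n%:R)^-1 @[n --> \oo] --> (m%:R : R))%classic.
  by have h' := cvgV mi hh; rewrite invrK in h'; exact: h'.
have h_le n : (h n <= n)%N.
  rewrite -(ler_nat R); apply: le_trans (_ : Num.sqrt (n%:R : R) / m%:R <= _).
    by rewrite truncn_le divr_ge0 ?sqrtr_ge0.
  rewrite ler_pdivrMr //; apply: le_trans (_ : n%:R <= _); last first.
    by rewrite ler_peMr // ler1n.
  case: n => [|n]; first by rewrite sqrtr0.
  rewrite -(@ler_sqr R) ?nnegrE ?sqrtr_ge0 // sqr_sqrtr // expr2.
  by rewrite ler_peMr // ler1n.
have cU : (A (n + h n)%N * Num.sqrt n%:R ^+ kappa / exp_sqrt R n @[n --> \oo] -->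
    c * expR (pi * (m%:R^-1 / 2)))%classic.
  apply: (@cvg_shift _ A (fun n => n + h n)%N) => //.
  by apply: cvg_near_eq hh; apply: nearW => n; rewrite natrD addrC addKr.
have cL : (A (n - h n)%N * Num.sqrt n%:R ^+ kappa / exp_sqrt R n @[n --> \oo] -->
    c * expR (pi * (- m%:R^-1 / 2)))%classic.
  apply: (@cvg_shift _ A (fun n => n - h n)%N) => //.
  apply: cvg_near_eq (cvgN hh); apply: nearW => n /=.
  by rewrite natrB // addrC addKr mulNr.
have U : (((h n)%:R / Num.sqrt n%:R)^-1 * (A (n + h n)%N * Num.sqrt n%:R ^+ kappa / exp_sqrt R n
     - A n * Num.sqrt n%:R ^+ kappa / exp_sqrt R n) @[n --> \oo] -->
    c * (m%:R * (1 * (expR (1 * (pi / 2 / m%:R)) - 1))))%classic.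
  rewrite [X in (_ --> X)%classic](_ : _ = m%:R * (c * expR (pi * (m%:R^-1 / 2)) - c)).
    by apply: cvgM => //; exact: cvgB.
  rewrite !mul1r (_ : pi / 2 / m%:R = pi * (m%:R^-1 / 2)); ring.
have L : (((h n)%:R / Num.sqrt n%:R)^-1 * (A n * Num.sqrt n%:R ^+ kappa / exp_sqrt R n
     - A (n - h n)%N * Num.sqrt n%:R ^+ kappa / exp_sqrt R n) @[n --> \oo] -->
    c * (m%:R * (-1 * (expR (-1 * (pi / 2 / m%:R)) - 1))))%classic.
  rewrite [X in (_ --> X)%classic](_ : _ = m%:R * (c - c * expR (pi * (- m%:R^-1 / 2)))).
    by apply: cvgM => //; exact: cvgB.
  rewrite (_ : -1 * (pi / 2 / m%:R) = pi * (- m%:R^-1 / 2)); ring.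
have {}U := (cvgrPdist_le _ _).1 U _ e2.
have {}L := (cvgrPdist_le _ _).1 L _ e2.
near=> n.
have n0 : (0 < n)%N by near: n; exact: nbhs_infty_gt.
have s0 : 0 < Num.sqrt (n%:R : R) by rewrite sqrtr_gt0 ltr0n.
have hn0 : 0 < (h n)%:R :> R.
  have : 0 < (h n)%:R / Num.sqrt n%:R :> R.
    by near: n; apply: (cvgr_gt _ hh); rewrite invr_gt0.
  by rewrite pmulr_lgt0 // invr_gt0.
have ge0 := exp_sqrt_gt0 R n.
have Un : `|c * (m%:R * (1 * (expR (1 * (pi / 2 / m%:R)) - 1))) -
   ((h n)%:R / Num.sqrt n%:R)^-1 * (A (n + h n)%N * Num.sqrt n%:R ^+ kappa / exp_sqrt R n
     - A n * Num.sqrt n%:R ^+ kappa / exp_sqrt R n)| <= eps / 2.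
  by near: n; exact: U.
have Ln : `|c * (m%:R * (-1 * (expR (-1 * (pi / 2 / m%:R)) - 1))) -
   ((h n)%:R / Num.sqrt n%:R)^-1 * (A n * Num.sqrt n%:R ^+ kappa / exp_sqrt R n
     - A (n - h n)%N * Num.sqrt n%:R ^+ kappa / exp_sqrt R n)| <= eps / 2.
  by near: n; exact: L.
have w0 : 0 < Num.sqrt (n%:R : R) ^+ kappa.+1 / exp_sqrt R n / (h n)%:R.
  by rewrite !divr_gt0 // exprn_gt0.
have fE x y : ((h n)%:R / Num.sqrt n%:R)^-1 * (x * Num.sqrt n%:R ^+ kappa / exp_sqrt R n
     - y * Num.sqrt n%:R ^+ kappa / exp_sqrt R n) =
    Num.sqrt (n%:R : R) ^+ kappa.+1 / exp_sqrt R n / (h n)%:R * (x - y).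
  by rewrite exprS; field; rewrite !gt_eqF.
rewrite !fE in Un Ln.
have aE : a n * Num.sqrt (n%:R : R) ^+ kappa.+1 / exp_sqrt R n =
   Num.sqrt (n%:R : R) ^+ kappa.+1 / exp_sqrt R n / (h n)%:R * ((h n)%:R * a n).
  by field; rewrite !gt_eqF.
have up := mul_increment_le n (h n) Aa a_homo.
have lo := mul_increment_ge (h_le n) Aa a_homo.
rewrite -(ler_pM2l w0) in up; rewrite -(ler_pM2l w0) in lo.
rewrite aE; move: hU hL Un Ln; rewrite !ler_distl => /andP[? ?] /andP[? ?] /andP[? ?] /andP[? ?].
by apply/andP; split; lra.
Unshelve. all: by end_near. Qed.

(** The constant is (2 pi^2)^-1 (pi / 2)^2 = 1 / 8, each differencing contributing pi / 2 and a
    factor sqrt n. *)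
Lemma cvg_of_theta_conv (p : nat -> R) :
  (forall N, theta_conv p N = (N == 0%N)%:R) -> (forall n, 0 <= p n) ->
  {homo p : i j / (i <= j)%N >-> i <= j} ->
  (p n * n%:R / exp_sqrt R n @[n --> \oo] --> (8^-1 : R))%classic.
Proof.
move=> p_theta p_ge0 p_homo; have pi0 := pi_gt0 R.
have h0 : (psum2 p n * Num.sqrt n%:R ^+ 0 / exp_sqrt R n @[n --> \oo] -->
    ((2 * pi ^+ 2)^-1 : R))%classic.
  apply: cvg_near_eq (cvg_psum2 p_theta p_ge0).
  by apply: nearW => n; rewrite expr0 mulr1.
have hS2 n : psum2 p n.+1 - psum2 p n = psum1 p n.
  by rewrite {1}/psum2 big_ord_recr /= -/(psum2 p n) addrAC subrr add0r.
have hS1 n : psum1 p n.+1 - psum1 p n = p n.+1.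
  by rewrite {1}/psum1 big_ord_recr /= -/(psum1 p n) addrAC subrr add0r.
have homo1 : {homo psum1 p : i j / (i <= j)%N >-> i <= j}.
  by apply: homo_leq => [//|? ? ?|n]; [exact: le_trans|exact: psum1_leS].
have homo2 : {homo (fun n => p n.+1) : i j / (i <= j)%N >-> i <= j}.
  by move=> i j ij; apply: p_homo.
have h2 := cvg_increments hS1 homo2 (cvg_increments hS2 homo1 h0).
(* The increment of [psum1] at n is p (n + 1), so the index is finally moved back by one, a shift
   with d = 0. *)
have hu : ((n.-1%:R - n%:R) / Num.sqrt (n%:R : R) @[n --> \oo] --> (0 : R))%classic.
  apply: (@cvg_dist_le _ _ (fun n => (Num.sqrt (n%:R : R))^-1)); last first.
    exact: cvg_inv_sqrt_natr.
  apply: nearW => -[|n]; first by rewrite subrr mul0r subrr normr0 invr_ge0 sqrtr_ge0.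
  by rewrite -natr1 opprD addrA subrr sub0r subr0 mulN1r normrN ger0_norm.
have := cvg_shift hu h2.
rewrite [X in (_ --> X)%classic -> _](_ : _ = 8^-1); last first.
  rewrite mul0r mulr0 expR0 mulr1.
  have : pi != 0 :> R by rewrite gt_eqF.
  by move: (pi : R) => q q0; field.
apply: cvg_trans; apply: near_eq_cvg.
by apply: filterS (nbhs_infty_gt 0) => n n0; rewrite prednK // sqr_sqrtr.
Qed.

End Increments.

(** * Monotonicity and asymptotics of [pbar] *)

Lemma is_overpartition_rcons1 n s :
  is_overpartition n s -> is_overpartition n.+1 (rcons s (1%N, false)).
Proof.
elim: s n => [|[k b] s IHs] n; first by rewrite is_overpartition_nil => /eqP->.
rewrite rcons_cons !is_overpartition_cons => /and5P[k0 kn ov ks kts].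
have ks' : parts_le k (rcons s (1%N, false)).
  by rewrite /parts_le /parts /unzip1 map_rcons all_rcons /= k0; exact: ks.
by rewrite k0 (leqW kn) subSn // IHs // ks' mem_rcons inE negb_or kts xpair_eqE andbF.
Qed.

Lemma pbar_leS n : (pbar n <= pbar n.+1)%N.
Proof.
rewrite -!size_ovlist -!count_predT.
apply: (@leq_count_ovlist _ _ (fun s => rcons s (1%N, false))) => [s ov_s _|s t _ _].
  by rewrite andbT is_overpartition_rcons1.
by move/rcons_inj => [].
Qed.

Lemma cvg_pbar (R : realType) :
  ((pbar n)%:R * n%:R / exp_sqrt R n @[n --> \oo] --> (8^-1 : R))%classic.
Proof.
apply: cvg_of_theta_conv => [N|n|]; first exact: theta_conv_pbar.
  by [].
apply: homo_leq => [//|? ? ?|n]; first exact: le_trans.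
by rewrite ler_nat pbar_leS.
Qed.
(** * Equidistribution of the rank *)

(** The plain 2 goes behind all parts at least 2, so an overlined 2 remains the first of its
    kind. *)
Fixpoint insert2 (s : seq (nat * bool)) : seq (nat * bool) :=
  if s is x :: s' then if (2 <= x.1)%N then x :: insert2 s' else (2%N, false) :: s
  else [:: (2%N, false)].

Lemma perm_insert2 s : perm_eq (insert2 s) ((2%N, false) :: s).
Proof.
elim: s => //= x s IHs; case: ifP => _; last exact: perm_refl.
by rewrite (perm_trans (_ : perm_eq _ (x :: (2%N, false) :: s))) ?perm_cons //
           (perm_catCA [:: x] [:: (2%N, false)]).
Qed.

Lemma head_insert2 s y t : insert2 s = y :: t -> (2 <= y.1)%N.
Proof. by case: s => [|x s] /=; [case=> <-|case: ifP => [x2 [<-]|_ [<-]]]. Qed.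

Lemma insert2_inj : injective insert2.
Proof.
have neq_nil s : insert2 s <> [::] by case: s => //= x s; case: ifP.
elim=> [|x s IHs] [|y t] //=.
- by case: ifP => // _ [_ /esym/neq_nil].
- by case: ifP => // _ [_ /neq_nil].
case: ifP => x2; case: ifP => y2; first by case=> -> /IHs ->.
- by case=> _ /head_insert2; rewrite y2.
- by case=> _ /esym/head_insert2; rewrite x2.
by case=> -> ->.
Qed.

Lemma parts_le_insert2 k s : (2 <= k)%N -> parts_le k (insert2 s) = parts_le k s.
Proof.
move=> k2; rewrite /parts_le (perm_all _ (perm_map fst (perm_insert2 s))) /=.
by rewrite k2.
Qed.

Lemma is_overpartition_insert2 n s :
  is_overpartition n s -> is_overpartition n.+2 (insert2 s).
Proof.
elim: s n => [|[k b] s IHs] n; first by rewrite is_overpartition_nil => /eqP->.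
rewrite is_overpartition_cons /=; case: ifP => [k2|/negbT].
  move=> /and5P[k0 kn ov ks kts]; rewrite is_overpartition_cons k0.
  rewrite (leq_trans kn) ?leqW // !subSn ?leqW // IHs //= parts_le_insert2 // ks /=.
  by rewrite (perm_mem (perm_insert2 s)) inE negb_or kts xpair_eqE andbF.
rewrite -leqNgt => k1 /[dup] ov /and5P[k0 kn ovs ks kts].
have ks1 : parts_le 1 ((k, b) :: s).
  by rewrite /parts_le /= k1; exact: parts_leW ks.
rewrite is_overpartition_cons /= !subSS subn0 is_overpartition_cons k0 kn ovs ks kts.
by rewrite (parts_leW _ ks1) //= (parts_le_true _ _ ks1).
Qed.

Lemma bigmax_parts_le m s : (\max_(k <- parts s) k <= m)%N = parts_le m s.
Proof.
rewrite /parts_le; elim: (parts s) => [|k u IHu]; first by rewrite big_nil.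
by rewrite big_cons geq_max IHu.
Qed.

Lemma rank_insert2 s : ~~ parts_le 1 s -> Defs.rank (insert2 s) = Defs.rank s - 1.
Proof.
rewrite -bigmax_parts_le -ltnNge => s2.
rewrite /Defs.rank (perm_size (perm_insert2 s)).
rewrite (perm_big _ (perm_map fst (perm_insert2 s))) /= big_cons (maxn_idPr s2).
by rewrite /parts -addn1 PoszD opprD addrA.
Qed.

Lemma rank_rcons1 s : ~~ parts_le 0 s ->
  Defs.rank (rcons s (1%N, false)) = Defs.rank s - 1.
Proof.
rewrite -bigmax_parts_le -ltnNge => s1.
rewrite /Defs.rank size_rcons /parts /unzip1 map_rcons -cats1 big_cat big_seq1 /=.
by rewrite (maxn_idPl s1) -addn1 PoszD opprD addrA.
Qed.

Definition rank_count (c : nat) (x : int) (n : nat) : nat :=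
  count (fun s => (Defs.rank s == x %[mod c])%Z) (ovlist n).

Lemma Nbar_rank_count a c n : Nbar a c n = rank_count c a n.
Proof. by rewrite /rank_count count_ovlist. Qed.

(** Only 1 + ... + 1 is left, its first part overlined or not. These are the exceptions for
    [insert2], where a new 2 also raises the largest part. *)
Lemma count_parts_le1 n : (count (parts_le 1) (ovlist n) <= 2)%N.
Proof.
have plain1 k : count (parts_le_plain 1) (ovlist k) = 1%N.
  elim: k => [|k IHk]; rewrite count_parts_le_plainS count_parts_le0 //=.
  by rewrite subSS subn0 IHk.
rewrite count_parts_leS count_parts_le0; case: n => [|n] //=.
by rewrite plain1.
Qed.

Lemma rank_count_le c x n (f : seq (nat * bool) -> seq (nat * bool)) (d : int) :
    injective f ->
    (forall s, is_overpartition n s -> is_overpartition n.+2 (f s)) ->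
    (forall s, ~~ parts_le 1 s -> Defs.rank (f s) = Defs.rank s - d) ->
  (rank_count c (x + d) n <= rank_count c x n.+2 + 2)%N.
Proof.
move=> f_inj f_ov f_rank; rewrite /rank_count.
set P := fun s => _; set Q := fun s => _.
have : (count (fun s => P s && ~~ parts_le 1 s) (ovlist n) <= count Q (ovlist n.+2))%N.
  apply: (leq_count_ovlist (f := f)) => [s ov_s /andP[Ps s1]|s t _ _]; last exact: f_inj.
  rewrite f_ov //= /Q f_rank //; move: Ps; rewrite /P !eqz_mod_dvd.
  by congr (_ %| _)%Z; ring.
have h1 := count_parts_le1 n; move=> h2; apply: leq_trans (leq_add h2 h1).
rewrite -count_predUI -[leqLHS]addn0; apply: leq_add => //.
by apply: sub_count => s /= Ps; rewrite Ps /=; case: parts_le.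
Qed.

Lemma rank_count_succ_le c x n :
  (rank_count c (x + 1) n <= rank_count c x n.+2 + 2)%N.
Proof.
by apply: rank_count_le; [exact: insert2_inj|exact: is_overpartition_insert2|exact: rank_insert2].
Qed.

Lemma rank_count_succ2_le c x n :
  (rank_count c (x + 2) n <= rank_count c x n.+2 + 2)%N.
Proof.
apply: (@rank_count_le _ _ _ (fun s => rcons (rcons s (1%N, false)) (1%N, false))).
- by move=> s t /rcons_inj [] /rcons_inj [].
- by move=> s ov_s; rewrite !is_overpartition_rcons1.
move=> s s1; have s0 : ~~ parts_le 0 s by apply: contra s1; exact: parts_leW.
rewrite rank_rcons1 ?rank_rcons1 //; first by ring.
by rewrite /parts_le /parts /unzip1 map_rcons all_rcons.
Qed.

Lemma sum_eq_mod (c : nat) (r x : int) : (0 < c)%N ->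
  (\sum_(i < c) ((r == x + i%:Z %[mod c])%Z : nat) = 1)%N.
Proof.
move=> c0; pose m := `|((r - x) %% c)%Z|%N.
have cz : c%:Z != 0 by rewrite eqz_nat -lt0n.
have m_c : (m < c)%N by have := ltz_mod (r - x) cz; have := modz_ge0 (r - x) cz; lia.
rewrite (bigD1 (Ordinal m_c)) //= big1 ?addn0.
  rewrite (_ : (_ == _)) // eqz_mod_dvd.
  rewrite /m gez0_abs ?modz_ge0 //.
  by rewrite opprD addrA -eqz_mod_dvd modz_mod.
move=> i; rewrite -val_eqE /= => i_m; apply/eqP; rewrite eqb0.
apply: contra i_m; rewrite eqz_mod_dvd opprD addrA -eqz_mod_dvd => /eqP E.
have := congr1 absz E; rewrite -/m => ->.
by rewrite modz_nat modn_small // absz_nat.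
Qed.

Lemma sum_rank_count c x n : (0 < c)%N ->
  (\sum_(i < c) rank_count c (x + i%:Z) n = pbar n)%N.
Proof.
move=> c0; rewrite -size_ovlist /rank_count.
elim: (ovlist n) => [|s L IHL] /=; first by rewrite big1.
by rewrite big_split /= IHL sum_eq_mod.
Qed.

Lemma rank_count_dist (c : nat) (x : int) n : (0 < c)%N ->
  (rank_count c (x + 1) n <= rank_count c (x + 2) n + (pbar n.+2 - pbar n) + 2 * c + 2)%N /\
  (rank_count c (x + 2) n <= rank_count c (x + 1) n + (pbar n.+2 - pbar n) + 2 * c + 2)%N.
Proof.
move=> c0.
(* The slacks in the hypothesis are nonnegative, and over all c residues they sum to pbar(n + 2) -
   pbar(n) + 2 c. Hence each single slack is at most that sum, which reverses the inequality. *)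
have up d : (forall y, (rank_count c (y + d) n <= rank_count c y n.+2 + 2)%N) ->
    (rank_count c x n.+2 <= rank_count c (x + d) n + (pbar n.+2 - pbar n) + 2 * c)%N.
  move=> hd; have := sum_rank_count x n.+2 c0; have := sum_rank_count (x + d) n c0.
  case: c c0 hd => // c _ hd; rewrite !big_ord_recl /= !addr0.
  have : (\sum_(i < c) rank_count c.+1 (x + d + (bump 0 i)%:Z) n <=
     \sum_(i < c) (rank_count c.+1 (x + (bump 0 i)%:Z) n.+2 + 2))%N.
    by apply: leq_sum => i _; rewrite addrAC.
  rewrite big_split /= sum_nat_const card_ord.
  by have := leq_trans (pbar_leS n) (pbar_leS n.+1); lia.
have := up 1 (fun y => rank_count_succ_le c y n).
have := up 2 (fun y => rank_count_succ2_le c y n).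
have := rank_count_succ_le c x n; have := rank_count_succ2_le c x n.
move: (rank_count _ _ _) (rank_count _ _ _) (rank_count _ _ _) => p q r.
by lia.
Qed.

(** * Equidistribution from the bound on neighbouring classes *)

Section RankAsymptotics.
Variable R : realType.
Variable c : nat.
Hypothesis c_gt0 : (0 < c)%N.

Definition pbar_gap n : R := (pbar n.+2)%:R - (pbar n)%:R + 2 * c%:R + 2.

Lemma rank_count_distS (x : int) n :
  `|(rank_count c (x + 1) n)%:R - (rank_count c x n)%:R| <= pbar_gap n.
Proof.
have [] := rank_count_dist (x - 1) n c_gt0.
rewrite subrK (_ : x - 1 + 2 = x + 1); last by ring.
have e : (pbar n.+2 - pbar n)%N%:R = (pbar n.+2)%:R - (pbar n)%:R :> R.
  by rewrite natrB // (leq_trans (pbar_leS _) (pbar_leS _)).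
have : (2 * c)%N%:R = 2 * c%:R :> R by rewrite natrM.
move: (2 * c)%N => q qE; rewrite -!(ler_nat R) !natrD e qE.
rewrite ler_distl /pbar_gap => h1 h2; apply/andP; split; lra.
Qed.

Lemma rank_count_distn (x : int) i n :
  `|(rank_count c (x + i%:Z) n)%:R - (rank_count c x n)%:R| <= i%:R * pbar_gap n.
Proof.
elim: i => [|i IHi]; first by rewrite addr0 subrr normr0 mul0r.
have := rank_count_distS (x + i%:Z) n.
rewrite -addrA (_ : i%:Z + 1 = i.+1%:Z); last by rewrite -addn1 PoszD.
move=> h; rewrite -natr1 mulrDl mul1r.
apply: le_trans (ler_distD (rank_count c (x + i%:Z) n)%:R _ _) _.
by lra.
Qed.

(** [pbar n] is the sum of the c classes x, ..., x + c - 1, each fewer than c steps away from x. *)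
Lemma rank_count_pbar_le (x : int) n :
  `|c%:R * (rank_count c x n)%:R - (pbar n)%:R| <= c%:R * (c%:R * pbar_gap n).
Proof.
rewrite -(sum_rank_count x n c_gt0) natr_sum.
have -> : c%:R * (rank_count c x n)%:R = \sum_(i < c) (rank_count c x n)%:R :> R.
  by rewrite sumr_const card_ord mulr_natl.
rewrite -sumrB; apply: le_trans (ler_norm_sum _ _ _) _.
have -> : c%:R * (c%:R * pbar_gap n) = \sum_(i < c) (c%:R * pbar_gap n).
  by rewrite sumr_const card_ord mulr_natl.
apply: ler_sum => i _; rewrite distrC.
apply: le_trans (rank_count_distn x i n) _; apply: ler_wpM2r.
  exact: le_trans (normr_ge0 _) (rank_count_distS x n).
by rewrite ler_nat ltnW.
Qed.

Lemma pbar_gt0 n : 0 < (pbar n)%:R :> R.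
Proof.
rewrite ltr0n; apply: leq_trans (_ : pbar 0 <= _)%N.
  by rewrite -size_ovlist -has_predT; apply/hasP; exists [::]; rewrite ?mem_ovlist.
by elim: n => // n IHn; exact: leq_trans IHn (pbar_leS n).
Qed.

Lemma cvg_inv_pbar : (((pbar n)%:R : R)^-1 @[n --> \oo] --> (0 : R))%classic.
Proof.
have h : (n%:R / exp_sqrt R n @[n --> \oo] --> (0 : R))%classic.
  (* With s = sqrt n, e^(pi s / 4) >= s / 2 gives e^(pi s) >= s^4 / 16, hence the constant 16. *)
  apply: (@cvg_dist_le _ _ (fun n => 16 * n%:R^-1)); last first.
    rewrite -[X in (_ --> X)%classic](mulr0 16); apply: cvgMl_tmp.
    by rewrite -(cvg_shiftS (fun n => n%:R^-1 : R)); exact: cvg_harmonic.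
  apply: filterS (nbhs_infty_gt 0) => n n0.
  have N0 : 0 < n%:R :> R by rewrite ltr0n.
  rewrite subr0 ger0_norm ?divr_ge0 ?expR_ge0 //.
  rewrite ler_pdivrMr ?expR_gt0 // mulrAC ler_pdivlMr // /exp_sqrt.
  set s := Num.sqrt _; have s0 : 0 <= s by exact: sqrtr_ge0.
  have -> : n%:R = s ^+ 2 by rewrite sqr_sqrtr.
  have e4 : expR (pi * s) = expR (pi * s / 4) ^+ 4.
    by rewrite -expRM_natl; congr expR; field.
  have h1 : s / 2 <= expR (pi * s / 4).
    have := expR_ge1Dx (pi * s / 4); have : 2 * s <= pi * s by rewrite ler_wpM2r ?pi_ge2.
    by lra.
  have h2 : (s / 2) ^+ 4 <= expR (pi * s / 4) ^+ 4.
    by rewrite lerXn2r ?nnegrE ?divr_ge0 ?expR_ge0.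
  rewrite e4; have : s ^+ 2 * s ^+ 2 = 16 * (s / 2) ^+ 4 by field.
  by lra.
have n8 : 8^-1 != 0 :> R by rewrite invr_neq0 ?pnatr_eq0.
rewrite -[X in (_ --> X)%classic](mul0r (8^-1^-1 : R)).
apply: cvg_near_eq (cvgM h (cvgV n8 (@cvg_pbar R))).
apply: filterS (nbhs_infty_gt 0) => n n0 /=.
have := pbar_gt0 n; have := exp_sqrt_gt0 R n; have : 0 < n%:R :> R by rewrite ltr0n.
by move=> ? ? ?; field; rewrite !gt_eqF.
Qed.

Lemma cvg_pbarSS : ((pbar n.+2)%:R / (pbar n)%:R @[n --> \oo] --> (1 : R))%classic.
Proof.
have hp : ((pbar n)%:R * Num.sqrt n%:R ^+ 2 / exp_sqrt R n @[n --> \oo] --> (8^-1 : R))%classic.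
  apply: cvg_near_eq (@cvg_pbar R); apply: nearW => n.
  by rewrite sqr_sqrtr.
have hu : ((n.+2%:R - n%:R) / Num.sqrt (n%:R : R) @[n --> \oo] --> (0 : R))%classic.
  rewrite -[X in (_ --> X)%classic](mulr0 (2 : R)); apply: cvg_near_eq (cvgMl_tmp (@cvg_inv_sqrt_natr R)).
  by apply: nearW => n; rewrite -addn2 natrD addrAC subrr add0r.
have h2 := cvg_shift (A := fun n => (pbar n)%:R) hu hp.
have n8 : 8^-1 != 0 :> R by rewrite invr_neq0 ?pnatr_eq0.
rewrite [X in (_ --> X)%classic](_ : _ = 8^-1 * expR (pi * (0 / 2)) * 8^-1^-1); last first.
  by rewrite mul0r mulr0 expR0 mulr1 mulfV.
apply: cvg_near_eq (cvgM h2 (cvgV n8 hp)).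
apply: filterS (nbhs_infty_gt 0) => n n0 /=.
have := pbar_gt0 n; have := exp_sqrt_gt0 R n.
have : 0 < Num.sqrt (n%:R : R) by rewrite sqrtr_gt0 ltr0n.
by move=> ? ? ?; field; rewrite !gt_eqF.
Qed.

Lemma cvg_rank_count (x : int) :
  ((rank_count c x n)%:R / ((pbar n)%:R / c%:R) @[n --> \oo] --> (1 : R))%classic.
Proof.
apply: (@cvg_dist_le _ _ (fun n => c%:R * c%:R *
   ((pbar n.+2)%:R / (pbar n)%:R - 1 + (2 * c%:R + 2) * (pbar n)%:R^-1))); last first.
  rewrite [X in (_ --> X)%classic](_ : _ = c%:R * c%:R * (1 - 1 + (2 * c%:R + 2) * 0)).
    apply: cvgMl_tmp; apply: cvgD; last exact: cvgMl_tmp cvg_inv_pbar.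
    by apply: cvgB; [exact: cvg_pbarSS|exact: cvg_cst].
  by ring.
apply: nearW => n; have p0 := pbar_gt0 n.
have C0 : c%:R != 0 :> R by rewrite pnatr_eq0 -lt0n.
have := rank_count_pbar_le x n.
rewrite -(ler_pM2l (_ : 0 < (pbar n)%:R^-1 :> R)) ?invr_gt0 //.
rewrite -[X in X * _ <= _](gtr0_norm (_ : 0 < (pbar n)%:R^-1 :> R)) ?invr_gt0 //.
rewrite -normrM => h; apply: le_trans (le_trans h _).
  rewrite le_eqVlt; apply/orP; left; apply/eqP; congr (`|_|).
  by field; rewrite gt_eqF.
rewrite le_eqVlt; apply/orP; left; apply/eqP; rewrite /pbar_gap.
by field; rewrite gt_eqF.
Qed.

End RankAsymptotics.
Theorem corollary1 (R : realType) (c a : nat) (hc : (2 <= c)%N)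
    (ha : (a <= c - 1)%N) :
  asymp_equiv (fun n : nat => (Nbar a c n)%:R : R)
              (fun n : nat => (pbar n)%:R / c%:R)
  /\
  asymp_equiv (fun n : nat => (pbar n)%:R / c%:R : R)
              (fun n : nat =>
                 1 / c%:R * (expR (pi * Num.sqrt n%:R) / (8 * n%:R))).
Proof.
have c_gt0 : (0 < c)%N by exact: leq_trans hc.
have C0 : c%:R != 0 :> R by rewrite pnatr_eq0 -lt0n.
rewrite /asymp_equiv; split.
  apply: cvg_near_eq (cvg_rank_count (R := R) c_gt0 a%:Z).
  by apply: nearW => n; rewrite Nbar_rank_count.
rewrite [X in (_ --> X)%classic](_ : _ = 8 * 8^-1); last by rewrite mulfV ?pnatr_eq0.
apply: cvg_near_eq (cvgMl_tmp (@cvg_pbar R)).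
apply: filterS (nbhs_infty_gt 0) => n n0.
rewrite -/(exp_sqrt R n); have := exp_sqrt_gt0 R n.
have : 0 < n%:R :> R by rewrite ltr0n.
by move=> ? ?; field; rewrite !gt_eqF // ltr0n.
Qed.
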